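(* For every $K>0$ there exists a constant $\alpha>0$ depending only on $K$ such that the following holds. Let $n,d$ be positive integers with $d\le \frac12 n^{2/3}$, and let $A$ be the adjacency matrix of a uniformly random $d$-regular digraph on $n$ vertices. Then $$\mathbb P\left(\sigma_2(A)\le \alpha\sqrt{d}\right)\ge 1-n^{-K}-e^{-n}.$$
   Context: A $d$-regular digraph on $n$ labelled vertices is a digraph in which each vertex has $d$ in-neighbors and $d$ out-neighbors (loops are allowed, multiple edges are not); its adjacency matrix is thus an $n\times n$ matrix with entries in $\{0,1\}$ all of whose row sums and column sums equal $d$. A uniformly random $d$-regular digraph is one whose adjacency matrix is uniform on the set of all such matrices (equivalently, the biadjacency matrix of a uniformly random bipartite $d$-regular graph on labelled classes $[n]$ and $[n]$). $\sigma_1(A)\ge\sigma_2(A)\ge\dots\ge\sigma_n(A)$ denote the singular values of $A$. *)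

(* Defs.v *)
From HB Require Import structures.
From mathcomp Require Import all_boot all_order all_algebra.
From mathcomp Require Import complex.
From mathcomp Require Import reals sequences exp.

Set Implicit Arguments.
Unset Strict Implicit.
Unset Printing Implicit Defensive.

Import Order.TTheory GRing.Theory Num.Theory.
Local Open Scope ring_scope.

(* A digraph on the labelled vertices 'I_n is its set of arcs (i, j), read
   i -> j: loops are allowed and multiple arcs are excluded by construction. *)
Definition digraph (n : nat) := {set 'I_n * 'I_n}.

Definition out_neighbors n (G : digraph n) (i : 'I_n) : {set 'I_n} :=
  [set j | (i, j) \in G].

Definition in_neighbors n (G : digraph n) (i : 'I_n) : {set 'I_n} :=
  [set j | (j, i) \in G].

Definition regular_digraphs (n d : nat) : {set digraph n} :=
  [set G : digraph n | [forall i : 'I_n,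
     (#|in_neighbors G i| == d) && (#|out_neighbors G i| == d)]].

Definition adjmx (R : realType) n (G : digraph n) : 'M[R]_n :=
  \matrix_(i, j) ((i, j) \in G)%:R.

(* [spectral_diag] is only available over a numClosedFieldType, hence the
   detour through R[i]; the eigenvalues of A^T A are real and nonnegative, so
   taking real parts loses nothing. *)
Definition singular_values (R : realType) n (A : 'M[R]_n) : seq R :=
  sort >=%R
    [seq Num.sqrt (complex.Re
       (spectral_diag (map_mx (real_complex R) (A^T *m A)) 0 i)) | i : 'I_n].

(* The k-th largest singular value for 1 <= k <= n (0 when k > n). *)
Definition sigma (R : realType) n (k : nat) (A : 'M[R]_n) : R :=
  (singular_values A)`_k.-1.

(* Probability of E for a uniformly random element of S; junk if S is empty. *)
Definition uniform_proba (R : realType) (T : finType) (S : {set T})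
    (E : pred T) : R :=
  #|[set x in S | E x]|%:R / #|S|%:R.

(* Main.v *)
(** Kahn-Szemeredi argument.  Write M = A - (d/n) J; since A and M agree on
    vectors orthogonal to 1, sigma_2(A) is at most the operator norm of M, which
    is controlled by z^T M w for z, w in a net of nonnegative integer vectors with
    squared norm at most 16 n.  Fix h with 4^h <= d < 4^(h+1).

    Light couples, z_i w_j <= 2^h: the corresponding linear functional f of A
    concentrates.  Switching three arcs along a 6-cycle compares
    E[A_ij exp(t f)] with (d/n) E[exp(t f)] up to a factor 1 + O(d/n) and an error
    of order t d/n sum Q_ij^2, for t of either sign; the loss d/n is affordable
    exactly because d <= n^(2/3).  By convexity this bounds the moment generating
    function, with probability 1 - e^(-n) for the whole net.

    Heavy couples, z_i w_j > 2^h: the same switching gives E exp(t e(S,T)) for the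
    number e(S,T) of arcs between two sets at every t >= 0.  A union bound yields,
    with probability 1 - n^(-K), one linear inequality for each (S, T) and each
    t = k/6; summing over dyadic level sets of z and w with k the logarithm of
    z_i w_j / 2^h gives O(n 2^h). *)

Require Import Defs.
From HB Require Import structures.
From mathcomp Require Import all_boot all_order all_algebra.
From mathcomp Require Import complex.
From mathcomp Require Import boolp reals sequences exp.
From mathcomp Require Import ring lra zify.

Set Implicit Arguments.
Unset Strict Implicit.
Unset Printing Implicit Defensive.

Import Order.TTheory GRing.Theory Num.Theory.
Local Open Scope ring_scope.

(** * Tail bounds from the moment generating function *)

(** The target for a bilinear form on net vectors is n 2^h, about n sqrt(d). A light functional has
    mean at most 256 n d, so a relative error d/n in the switching counts shifts it by order d^2,
    which is O(n 2^h) for d <= n^(2/3). Its weights are at most 2^h, so t = 2^(-h) keeps every t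
    Q_ij below 1, and the term t (d/n) sum Q_ij^2 is again O(n 2^h). A further deviation of 36 n 2^h
    has probability at most 2 e^(-36 n), enough for the at most 2^(34 n) couples of net vectors. For
    heavy couples the mean itself is O(n 2^h), so a constant factor on it may be lost, and t is then
    free to grow. The net is nonnegative because a switching is estimated by ignoring the arcs that
    it removes, which requires nonnegative weights. *)

Section Tail.
Variables (R : realType) (T : finType).
Implicit Types (S : {set T}) (h : T -> R).

(** The hypothesis bounds by [L] the derivative at [theta] of the logarithm of the moment generating
    function. That logarithm is convex, so it grows by at most [theta * L] over [[0, theta]]: one
    value of [theta] suffices and nothing is integrated. No sign is imposed on [h], so both tails
    are covered. *)
Lemma chernoff S h (theta L tau : R) : 0 <= theta ->
  \sum_(G in S) h G * expR (theta * h G) <= L * \sum_(G in S) expR (theta * h G) ->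
  #|[set G in S | tau < h G]|%:R <= expR (- (theta * (tau - L))) * #|S|%:R.
Proof.
move=> th0 Hm.
set m := \sum_(G in S) expR (theta * h G) in Hm.
have m_ge : expR (theta * tau) * #|[set G in S | tau < h G]|%:R <= m.
  rewrite -sum1_card natr_sum mulr_sumr.
  rewrite (eq_bigl (fun G => (G \in S) && (tau < h G))); last by move=> G; rewrite inE.
  rewrite big_mkcondr /= /m; apply: ler_sum => G GS.
  case: ltP => [lt|_]; last exact: expR_ge0.
  by rewrite mulr1 ler_expR ler_wpM2l// ltW.
(* The tangent line of exp at L gives exp(-theta h) >= exp(-theta L) (1 - theta (h - L)),
   and the hypothesis says that h <= L on average for the weights exp(theta h). *)
have m_le : expR (- (theta * L)) * m <= #|S|%:R.
  have -> : #|S|%:R = \sum_(G in S) expR (theta * h G) * expR (- (theta * h G)).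
    rewrite (eq_bigr (fun=> 1)) => [|G _]; first by rewrite sumr_const.
    by rewrite expRxMexpNx_1.
  apply: (@le_trans _ _ (\sum_(G in S) expR (- (theta * L)) *
      ((1 + theta * L) * expR (theta * h G) - theta * (h G * expR (theta * h G))))).
    rewrite -mulr_sumr ler_wpM2l ?expR_ge0// big_split/= -mulr_sumr sumrN -mulr_sumr.
    rewrite -/m mulrDl mul1r -addrA lerDl subr_ge0 -mulrA.
    exact: ler_wpM2l.
  apply: ler_sum => G GS.
  have -> : - (theta * h G) = - (theta * L) + (- (theta * (h G - L))) by ring.
  rewrite expRD.
  have := expR_ge1Dx (- (theta * (h G - L))).
  set e1 := expR _ => le1.
  have e0 := expR_ge0 (- (theta * L)); have e2 := expR_ge0 (theta * h G).
  rewrite [leLHS](_ : _ = expR (- (theta * L)) *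
    (expR (theta * h G) * (1 + - (theta * (h G - L))))); last by ring.
  by rewrite [leRHS]mulrCA ler_wpM2l// ler_wpM2l.
rewrite mulrBr opprB expRD -mulrA mulrC -mulrA.
have etau := expR_gt0 (theta * tau).
rewrite -(ler_pM2l etau) (le_trans m_ge)//.
have eL := expR_gt0 (- (theta * L)).
rewrite -(ler_pM2l eL) (le_trans m_le)//.
rewrite [leRHS](_ : _ = expR (theta * L) * expR (- (theta * L)) *
   (expR (theta * tau) * expR (- (theta * tau))) * #|S|%:R); last by ring.
by rewrite !expRxMexpNx_1 !mul1r.
Qed.

Lemma card_exists_le (I : finType) S (P : pred I) (E : I -> pred T) :
  #|[set G in S | [exists x, P x && E x G]]|%:R <=
  \sum_(x | P x) #|[set G in S | E x G]|%:R :> R.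
Proof.
rewrite -natr_sum ler_nat -sum1_card.
rewrite (eq_bigl (fun G => (G \in S) && [exists x, P x && E x G])) => [|G]; last first.
  by rewrite inE.
rewrite (eq_bigr (fun x => \sum_(G in S | E x G) 1)%N); last first.
  by move=> x _; rewrite -sum1_card; apply: eq_bigl => G; rewrite inE.
rewrite big_mkcondr/=.
under [X in (_ <= X)%N]eq_bigr do rewrite big_mkcondr/=.
rewrite exchange_big/=; apply: leq_sum => G GS.
case: existsP => // -[x /andP[Px Ex]].
by rewrite (bigD1 x)//= Ex leq_addr.
Qed.

End Tail.

(** * Switchings *)

Section Switch.
Variable n : nat.
Implicit Types (G : digraph n) (i j u v p q r c : 'I_n).

(* The 6-cycle is used rather than the 4-cycle because the number of inverse moves
   creating a given arc (i, j) is then nearly constant, which the lower tail needs. *)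
Definition switch_cells i j u v p q : {set 'I_n * 'I_n} :=
  [set (i, j); (u, v); (p, q); (i, q); (u, j); (p, v)].

Definition switch i j u v p q G : digraph n :=
  [set x | (x \in G) (+) (x \in switch_cells i j u v p q)].

Definition switchable i j u v p q G :=
  [&& (i, j) \in G, (u, v) \in G, (p, q) \in G,
      (i, q) \notin G, (u, j) \notin G & (p, v) \notin G].

Definition unswitchable i j u v p q G :=
  [&& (i, j) \notin G, (u, v) \notin G, (p, q) \notin G,
      (i, q) \in G, (u, j) \in G & (p, v) \in G].

Lemma switchK i j u v p q : involutive (switch i j u v p q).
Proof. by move=> G; apply/setP => x; rewrite !inE addbK. Qed.

Lemma in_switch i j u v p q G x :
  (x \in switch i j u v p q G) = (x \in G) (+) (x \in switch_cells i j u v p q).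
Proof. by rewrite inE. Qed.

Lemma switchable_switch i j u v p q G :
  switchable i j u v p q (switch i j u v p q G) = unswitchable i j u v p q G.
Proof.
rewrite /switchable /unswitchable !in_switch !in_setU !in_set1 !eqxx !orbT /=.
by rewrite !addbT !negbK.
Qed.

(** Undoing a switching is a switching of the same shape, so regularity is checked in one direction
    only. *)
Lemma unswitchable_switchable i j u v p q G :
  unswitchable i j u v p q G = switchable i q p v u j G.
Proof.
rewrite /switchable /unswitchable.
by case: (_ \in _); case: (_ \in _); case: (_ \in _); case: (_ \in _);
  case: (_ \in _); case: (_ \in _).
Qed.

Lemma switch_sym i j u v p q G : switch i j u v p q G = switch i q p v u j G.
Proof.
apply/setP => x; rewrite !inE; congr (_ (+) _).
by case: (x == _); case: (x == _); case: (x == _); case: (x == _);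
  case: (x == _); case: (x == _).
Qed.

(** The membership conditions force [i], [u], [p] to be distinct, and likewise [j], [v], [q]: a
    coincidence would put one cell both in and out of [G]. In this form the change visibly has zero
    row and column sums. *)
Lemma switch_entry i j u v p q G r c : switchable i j u v p q G ->
  ((r, c) \in switch i j u v p q G)%:R = ((r, c) \in G)%:R
   + (r == i)%:R * ((c == q)%:R - (c == j)%:R)
   + (r == u)%:R * ((c == j)%:R - (c == v)%:R)
   + (r == p)%:R * ((c == v)%:R - (c == q)%:R) :> int.
Proof.
move=> /and5P[ij uv pq iq /andP[uj pv]].
have iu : (i == u) = false by apply: contraNF uj => /eqP <-.
have up : (u == p) = false by apply: contraNF pv => /eqP <-.
have ip : (i == p) = false by apply: contraNF iq => /eqP ->.
have jq : (j == q) = false by apply: contraNF iq => /eqP <-.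
have jv : (j == v) = false by apply: contraNF uj => /eqP ->.
have vq : (v == q) = false by apply: contraNF pv => /eqP ->.
rewrite in_switch !in_setU !in_set1 !xpair_eqE.
have [->|ri] := eqVneq r i; [|have [->|ru] := eqVneq r u; [|have [->|rp] := eqVneq r p]];
 rewrite ?eqxx ?(negPf ri) ?(negPf ru) ?(negPf rp) ?iu ?up ?ip
   1?[u == i]eq_sym 1?[p == i]eq_sym 1?[p == u]eq_sym ?iu ?up ?ip /=;
 (have [->|cj] := eqVneq c j; [|have [->|cv] := eqVneq c v; [|have [->|cq] := eqVneq c q]]);
 rewrite ?eqxx ?(negPf cj) ?(negPf cv) ?(negPf cq) ?jq ?jv ?vq
   1?[v == j]eq_sym 1?[q == j]eq_sym 1?[q == v]eq_sym ?jq ?jv ?vq /=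
   ?ij ?uv ?pq ?(negPf iq) ?(negPf uj) ?(negPf pv) ?addbF ?mul0r ?subrr ?mulr0 ?addr0 //=.
Qed.

Lemma regular_digraphsP (R : numDomainType) d G :
  reflect (forall i, \sum_j ((j, i) \in G)%:R = d%:R :> R /\
                     \sum_j ((i, j) \in G)%:R = d%:R :> R)
          (G \in regular_digraphs n d).
Proof.
have inE' i : \sum_j ((j, i) \in G)%:R = #|in_neighbors G i|%:R :> R.
  rewrite -sum1_card natr_sum [RHS]big_mkcond; apply: eq_bigr => j _.
  by rewrite inE; case: (_ \in _).
have outE i : \sum_j ((i, j) \in G)%:R = #|out_neighbors G i|%:R :> R.
  rewrite -sum1_card natr_sum [RHS]big_mkcond; apply: eq_bigr => j _.
  by rewrite inE; case: (_ \in _).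
rewrite inE; apply: (iffP forallP) => H i.
  by have /andP[/eqP h1 /eqP h2] := H i; rewrite inE' outE h1 h2.
have [h1 h2] := H i.
by rewrite -(eqr_nat R) -(eqr_nat R) -inE' -outE h1 h2 !eqxx.
Qed.


Lemma switch_regular d i j u v p q G : switchable i j u v p q G ->
  G \in regular_digraphs n d -> switch i j u v p q G \in regular_digraphs n d.
Proof.
move=> sG /(regular_digraphsP int) GS; apply/(regular_digraphsP int) => r.
have delta1 c : \sum_x (x == c)%:R = 1 :> int.
  by rewrite (bigD1 c)//= eqxx big1 ?addr0// => x /negPf ->.
have [GS1 GS2] := GS r; split; [rewrite -{}GS1 | rewrite -{}GS2].
  under eq_bigr do rewrite switch_entry//.
  rewrite !big_split/=.
  by rewrite -!mulr_suml !delta1 !mul1r; ring.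
under eq_bigr do rewrite switch_entry//.
rewrite !big_split/= -!addrA -!mulr_sumr.
by rewrite !big_split/= !sumrN !delta1 !subrr !mulr0 !addr0.
Qed.

Lemma sum_switch (R : numDomainType) d i j u v p q (g : digraph n -> R) :
  \sum_(G in regular_digraphs n d | switchable i j u v p q G) g G =
  \sum_(G in regular_digraphs n d | unswitchable i j u v p q G)
     g (switch i j u v p q G).
Proof.
rewrite (reindex_inj (inv_inj (switchK i j u v p q))); apply: eq_bigl => G.
rewrite switchable_switch andbC [RHS]andbC; case sG: unswitchable => //=.
apply/idP/idP => GS; last first.
  by rewrite switch_sym switch_regular -?unswitchable_switchable.
by rewrite -(switchK i j u v p q G) switch_regular// switchable_switch.
Qed.

End Switch.

(** * Moment generating functions of arc sums *)

Section PathSums.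
Variables (R : realType) (n : nat) (d : R) (a : 'I_n -> 'I_n -> R).
Hypothesis row_sum : forall i, \sum_j a i j = d.
Hypothesis col_sum : forall j, \sum_i a i j = d.

Lemma total_sum : \sum_i \sum_j a i j = n%:R * d.
Proof.
under eq_bigr do rewrite row_sum.
by rewrite sumr_const card_ord mulr_natl.
Qed.

Lemma sum_common_head i : \sum_p \sum_q a i q * a p q = d ^+ 2.
Proof.
rewrite exchange_big /=.
under eq_bigr do rewrite -mulr_sumr col_sum.
by rewrite -mulr_suml row_sum expr2.
Qed.

Lemma sum_common_tail j : \sum_u \sum_v a u j * a u v = d ^+ 2.
Proof.
under eq_bigr do rewrite -mulr_sumr row_sum.
by rewrite -mulr_suml col_sum expr2.
Qed.

(** These are the three arcs that an inverse switching at [(i, j)] removes. They share no index once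
    [i] and [j] are fixed, and contribute [d], [d] and [n d]. *)
Lemma sum_three_free i j :
  \sum_u \sum_v \sum_p \sum_q a i q * a u j * a p v = n%:R * d ^+ 3.
Proof.
transitivity (\sum_u \sum_(v < n) a u j * d ^+ 2).
  apply: eq_bigr => u _; apply: eq_bigr => v _.
  under eq_bigr do rewrite -mulr_suml -mulr_suml row_sum.
  by rewrite -mulr_sumr col_sum; ring.
under eq_bigr do rewrite sumr_const card_ord.
by rewrite sumrMnl -mulr_suml col_sum -mulr_natl; ring.
Qed.

Lemma sum_three_uv i j (c : 'I_n -> 'I_n -> R) :
  \sum_u \sum_v \sum_p \sum_q c u v * (a i q * a u j * a p v) =
  d ^+ 2 * \sum_u \sum_v c u v * a u j.
Proof.
rewrite mulr_sumr; apply: eq_bigr => u _; rewrite mulr_sumr; apply: eq_bigr => v _.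
under eq_bigr do rewrite -mulr_sumr -mulr_suml -mulr_suml row_sum.
by rewrite -mulr_sumr -mulr_sumr col_sum; ring.
Qed.

Lemma sum_three_pq i j (c : 'I_n -> 'I_n -> R) :
  \sum_u \sum_v \sum_p \sum_q c p q * (a i q * a u j * a p v) =
  d ^+ 2 * \sum_p \sum_q c p q * a i q.
Proof.
transitivity (\sum_u a u j * \sum_v \sum_p a p v * \sum_q c p q * a i q).
  apply: eq_bigr => u _; rewrite mulr_sumr; apply: eq_bigr => v _.
  rewrite mulr_sumr; apply: eq_bigr => p _.
  rewrite !mulr_sumr; apply: eq_bigr => q _; ring.
rewrite -mulr_suml col_sum exchange_big/= expr2 -mulrA; congr (_ * _).
rewrite mulr_sumr; apply: eq_bigr => p _.
by rewrite -mulr_suml row_sum.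
Qed.

(** Choose three arcs [(i, q)], [(u, j)], [(p, v)] independently: [u] is the tail of one and [v] the
    head of another, so by regularity [(u, v)] is uniform over all cells. The same holds for
    [(p, q)] and [(i, j)] below. *)
Lemma sum_six_uv (c : 'I_n -> 'I_n -> R) :
  \sum_i \sum_j \sum_u \sum_v \sum_p \sum_q c u v * (a i q * a u j * a p v) =
  n%:R * d ^+ 3 * \sum_u \sum_v c u v.
Proof.
under eq_bigr do under eq_bigr do rewrite sum_three_uv.
rewrite sumr_const card_ord -[LHS]mulr_natl -mulr_sumr exchange_big/=.
rewrite -mulrA; congr (_ * _); rewrite (exprSr d 2) -mulrA; congr (_ * _).
rewrite mulr_sumr; apply: eq_bigr => u _; rewrite exchange_big mulr_sumr/=.
by apply: eq_bigr => v _; rewrite -mulr_sumr row_sum mulrC.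
Qed.

Lemma sum_six_pq (c : 'I_n -> 'I_n -> R) :
  \sum_i \sum_j \sum_u \sum_v \sum_p \sum_q c p q * (a i q * a u j * a p v) =
  n%:R * d ^+ 3 * \sum_p \sum_q c p q.
Proof.
under eq_bigr do under eq_bigr do rewrite sum_three_pq.
under eq_bigr do rewrite sumr_const card_ord.
rewrite sumrMnl -[LHS]mulr_natl -mulr_sumr exchange_big/=.
rewrite -mulrA; congr (_ * _); rewrite (exprSr d 2) -mulrA; congr (_ * _).
rewrite mulr_sumr; apply: eq_bigr => p _; rewrite exchange_big mulr_sumr/=.
by apply: eq_bigr => q _; rewrite -mulr_sumr col_sum mulrC.
Qed.

Lemma sum_six_ij (c : 'I_n -> 'I_n -> R) :
  \sum_i \sum_j \sum_u \sum_v \sum_p \sum_q c i j * (a i q * a u j * a p v) =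
  n%:R * d ^+ 3 * \sum_i \sum_j c i j.
Proof.
rewrite mulr_sumr; apply: eq_bigr => i _; rewrite mulr_sumr; apply: eq_bigr => j _.
under eq_bigr do under eq_bigr do under eq_bigr do rewrite -mulr_sumr.
under eq_bigr do under eq_bigr do rewrite -mulr_sumr.
under eq_bigr do rewrite -mulr_sumr.
by rewrite -mulr_sumr sum_three_free mulrC.
Qed.

(** [x (x + y + z) <= 2 x^2 + y^2 / 2 + z^2 / 2], and each of the three cells is uniform, so the
    coefficients add up to 3. *)
Lemma sum_six_quad (Q : 'I_n -> 'I_n -> R) : (forall i j, 0 <= a i j) ->
  (forall i j, 0 <= Q i j) ->
  \sum_i \sum_j \sum_u \sum_v \sum_p \sum_q
    Q i j * (Q i j + Q u v + Q p q) * (a i q * a u j * a p v) <=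
  3 * (n%:R * d ^+ 3 * \sum_i \sum_j Q i j ^+ 2).
Proof.
move=> a0 Q0.
pose c i j := Q i j ^+ 2.
have -> : 3 * (n%:R * d ^+ 3 * \sum_i \sum_j Q i j ^+ 2) =
    2 * (n%:R * d ^+ 3 * \sum_i \sum_j c i j) +
    2^-1 * (n%:R * d ^+ 3 * \sum_i \sum_j c i j) +
    2^-1 * (n%:R * d ^+ 3 * \sum_i \sum_j c i j).
  by rewrite -/c; field.
rewrite -{1}sum_six_ij -{1}sum_six_uv -sum_six_pq.
rewrite 3!mulr_sumr -!big_split/=; apply: ler_sum => i _.
rewrite 3!mulr_sumr -!big_split/=; apply: ler_sum => j _.
rewrite 3!mulr_sumr -!big_split/=; apply: ler_sum => u _.
rewrite 3!mulr_sumr -!big_split/=; apply: ler_sum => v _.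
rewrite 3!mulr_sumr -!big_split/=; apply: ler_sum => p _.
rewrite 3!mulr_sumr -!big_split/=; apply: ler_sum => q _.
set A := a i q * a u j * a p v; have A0 : 0 <= A by rewrite !mulr_ge0.
rewrite [leRHS](_ : _ = (2 * c i j + 2^-1 * c u v + 2^-1 * c p q) * A); last by ring.
apply: ler_wpM2r => //.
rewrite /c; have := sqr_ge0 (Q i j - Q u v); have := sqr_ge0 (Q i j - Q p q).
nra.
Qed.

Hypothesis a01 : forall i j, 0 <= a i j <= 1.

(** Of the [(n d)^2] couples of arcs, each of the three cells required to be empty excludes
    [n d * d^2]; the union bound is [(1 - x)(1 - y)(1 - z) >= 1 - x - y - z]. *)
Lemma switchable_count_ge i j :
  n%:R * d * (n%:R * d - 3 * d ^+ 2) <=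
  \sum_u \sum_v \sum_p \sum_q
    a u v * a p q * ((1 - a i q) * (1 - a u j) * (1 - a p v)).
Proof.
have -> : n%:R * d * (n%:R * d - 3 * d ^+ 2) =
    \sum_u \sum_v \sum_p \sum_q
      (a u v * a p q - a u v * (a i q * a p q) - a u j * a u v * a p q
       - a u v * (a p v * a p q)).
  have pull x (b : 'I_n -> 'I_n -> R) :
      \sum_p \sum_q x * b p q = x * \sum_p \sum_q b p q.
    by rewrite mulr_sumr; apply: eq_bigr => p _; rewrite mulr_sumr.
  transitivity (\sum_u \sum_v (a u v * (n%:R * d - 2 * d ^+ 2)
                                - a u j * a u v * (n%:R * d))).
    under eq_bigr do rewrite sumrB -!mulr_suml.
    by rewrite sumrB -!mulr_suml total_sum sum_common_tail; ring.
  apply: eq_bigr => u _; apply: eq_bigr => v _.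
  under eq_bigr do rewrite !sumrB.
  by rewrite !sumrB !pull total_sum sum_common_head sum_common_tail; ring.
apply: ler_sum => u _; apply: ler_sum => v _; apply: ler_sum => p _.
apply: ler_sum => q _.
have /andP[x0 _] := a01 u v; have /andP[y0 _] := a01 p q.
have := a01 i q; have := a01 u j; have := a01 p v.
move: (a i q) (a u j) (a p v) => b1 b2 b3 /andP[b30 b31] /andP[b20 b21] /andP[b10 b11].
have xy0 := mulr_ge0 x0 y0.
rewrite [leLHS](_ : _ = a u v * a p q * (1 - b1 - b2 - b3)); last by ring.
apply: ler_wpM2l => //.
have h2 : 0 <= 1 - b2 by rewrite subr_ge0.
have := mulr_ge0 b10 b20; have := mulr_ge0 (mulr_ge0 b10 b30) h2.
have := mulr_ge0 b10 b30; have := mulr_ge0 b20 b30.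
nra.
Qed.

Lemma switchable_count_le i j :
  \sum_u \sum_v \sum_p \sum_q
    a u v * a p q * ((1 - a i q) * (1 - a u j) * (1 - a p v)) <= (n%:R * d) ^+ 2.
Proof.
have -> : (n%:R * d) ^+ 2 = \sum_u \sum_v \sum_p \sum_q a u v * a p q.
  under eq_bigr do under eq_bigr do under eq_bigr do rewrite -!mulr_sumr.
  under eq_bigr do under eq_bigr do rewrite -!mulr_sumr total_sum.
  under eq_bigr do rewrite -!mulr_suml.
  by rewrite -!mulr_suml total_sum expr2.
apply: ler_sum => u _; apply: ler_sum => v _; apply: ler_sum => p _.
apply: ler_sum => q _.
have /andP[x0 _] := a01 u v; have /andP[y0 _] := a01 p q.
have /andP[? ?] := a01 i q; have /andP[? ?] := a01 u j; have /andP[? ?] := a01 p v.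
rewrite ler_piMr ?mulr_ge0//.
by rewrite !mulr_ile1 ?mulr_ge0// ?subr_ge0// ?gerBl.
Qed.

(** The condition on [(i, j)] is kept exactly, as it does not depend on the summation indices. The
    union bound concerns [(u, v)] and [(p, q)] only, each of which is an arc for [d^4] triples. *)
Lemma unswitchable_count_ge i j :
  (1 - a i j) * (n%:R * d ^+ 3) - 2 * d ^+ 4 <=
  \sum_u \sum_v \sum_p \sum_q
    (1 - a i j) * (1 - a u v) * (1 - a p q) * (a i q * a u j * a p v).
Proof.
have -> : (1 - a i j) * (n%:R * d ^+ 3) - 2 * d ^+ 4 =
    \sum_u \sum_v \sum_p \sum_q
      ((1 - a i j) * (a i q * a u j * a p v) - a u v * (a i q * a u j * a p v)
       - a p q * (a i q * a u j * a p v)).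
  under eq_bigr do under eq_bigr do under eq_bigr do rewrite !sumrB -mulr_sumr.
  under eq_bigr do under eq_bigr do rewrite !sumrB -mulr_sumr.
  under eq_bigr do rewrite !sumrB -mulr_sumr.
  rewrite !sumrB -mulr_sumr sum_three_uv sum_three_pq sum_three_free.
  under [in X in _ - X - _]eq_bigr do under eq_bigr do rewrite mulrC.
  under [in X in _ - X]eq_bigr do under eq_bigr do rewrite mulrC.
  by rewrite sum_common_tail sum_common_head; ring.
apply: ler_sum => u _; apply: ler_sum => v _; apply: ler_sum => p _.
apply: ler_sum => q _.
have /andP[x0 x1] := a01 i j; have /andP[y0 y1] := a01 u v; have /andP[z0 z1] := a01 p q.
have /andP[? ?] := a01 i q; have /andP[? ?] := a01 u j; have /andP[? ?] := a01 p v.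
rewrite -!mulrBl; apply: ler_wpM2r; first by rewrite !mulr_ge0.
move: x0 x1 y0 y1 z0 z1.
move: (a i j) (a u v) (a p q) => x y z x0 x1 y0 y1 z0 z1.
have := mulr_ge0 x0 y0; have := mulr_ge0 x0 z0.
have h : 0 <= 1 - x by rewrite subr_ge0.
have := mulr_ge0 y0 z0; have := mulr_ge0 (mulr_ge0 y0 z0) h.
nra.
Qed.

End PathSums.

(** * Switching inequalities for exponential moments *)

Section Mgf.
Variables (R : realType) (n d : nat).
Implicit Types (G : digraph n) (i j u v p q r c : 'I_n) (Q : 'I_n -> 'I_n -> R).

Definition arc_sum Q G : R := \sum_i \sum_j Q i j * ((i, j) \in G)%:R.

Local Notation a G i j := (((i, j) \in G)%:R : R).
Local Notation D := (d%:R : R).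
Local Notation N := (n%:R : R).
Local Notation S := (regular_digraphs n d).

Lemma indicator01 (b : bool) : 0 <= (b%:R : R) <= 1.
Proof. by case: b; rewrite ?lexx ?ler01. Qed.

(** Nonnegative weights allow the removed arcs to be ignored; what remains involves only the created
    cells, which are uniform over inverse switchings. The same upper bound serves both signs of the
    exponent. *)
Lemma arc_sum_switch Q i j u v p q G : (forall r c, 0 <= Q r c) ->
  unswitchable i j u v p q G ->
  arc_sum Q (switch i j u v p q G) <= arc_sum Q G + (Q i j + Q u v + Q p q).
Proof.
move=> Q0 /and5P[_ _ _ iq /andP[uj pv]].
have deltaE s t : Q s t = \sum_r \sum_c Q r c * ((r, c) == (s, t))%:R.
  rewrite pair_big/= (bigD1 (s, t))//= eqxx mulr1 big1 ?addr0// => -[r c] /negPf/= ->.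
  by rewrite mulr0.
rewrite (deltaE i j) (deltaE u v) (deltaE p q) /arc_sum -!big_split/=.
apply: ler_sum => r _; rewrite -!big_split/=; apply: ler_sum => c _.
rewrite -!mulrDr; apply: ler_wpM2l => //.
rewrite -!natrD ler_nat in_switch !in_setU !in_set1.
case: ((r, c) =P (i, q)) => [->|_]; first by rewrite iq; lia.
case: ((r, c) =P (u, j)) => [->|_]; first by rewrite uj; lia.
case: ((r, c) =P (p, v)) => [->|_]; first by rewrite pv; lia.
by case: (_ \in G); case: (_ == (i, j)); case: (_ == (u, v)); case: (_ == (p, q)).
Qed.

Lemma exchange_big4 (F : 'I_n -> 'I_n -> 'I_n -> 'I_n -> digraph n -> R) :
  \sum_u \sum_v \sum_p \sum_q \sum_(G in S) F u v p q G =
  \sum_(G in S) \sum_u \sum_v \sum_p \sum_q F u v p q G.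
Proof.
rewrite [RHS]exchange_big; apply: eq_bigr => u _.
rewrite [RHS]exchange_big; apply: eq_bigr => v _.
rewrite [RHS]exchange_big; apply: eq_bigr => p _.
by rewrite [RHS]exchange_big.
Qed.

(** Double counting of the pairs of digraphs related by a switching that removes [(i, j)]: the left
    side counts the moves from [G], the right side lists them from the other end. *)
Lemma sum_switchable i j (g : digraph n -> R) :
  \sum_(G in S) a G i j * g G * (\sum_u \sum_v \sum_p \sum_q
     a G u v * a G p q * ((1 - a G i q) * (1 - a G u j) * (1 - a G p v))) =
  \sum_u \sum_v \sum_p \sum_q \sum_(G in S | unswitchable i j u v p q G)
     g (switch i j u v p q G).
Proof.
under [RHS]eq_bigr do under eq_bigr do under eq_bigr do under eq_bigr do
  rewrite -sum_switch big_mkcondr/=.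
rewrite exchange_big4; apply: eq_bigr => G GS.
rewrite mulr_sumr; apply: eq_bigr => u _; rewrite mulr_sumr; apply: eq_bigr => v _.
rewrite mulr_sumr; apply: eq_bigr => p _; rewrite mulr_sumr; apply: eq_bigr => q _.
rewrite /switchable; case: ((i, j) \in G); last by rewrite !mul0r.
case: ((u, v) \in G); last by rewrite !mul0r mulr0.
case: ((p, q) \in G); last by rewrite mulr0 mul0r mulr0.
case: ((i, q) \in G); first by rewrite subrr !mul0r !mulr0.
case: ((u, j) \in G); first by rewrite subrr mulr0 mul0r !mulr0.
case: ((p, v) \in G); first by rewrite subrr !mulr0.
by rewrite /= subr0 !mul1r !mulr1.
Qed.

Lemma regular_row G : G \in S -> forall i, \sum_j a G i j = D.
Proof. by move=> /(regular_digraphsP R) H i; have [] := H i. Qed.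

Lemma regular_col G : G \in S -> forall j, \sum_i a G i j = D.
Proof. by move=> /(regular_digraphsP R) H i; have [] := H i. Qed.

(** Sum over the inverse switchings of [G], weighted by the created cell [(i, j)] and by the growth
    of the exponential. The three absence conditions are dropped, as an upper bound permits. *)
Definition switch_mgf (theta : R) Q G : R :=
  \sum_i \sum_j \sum_u \sum_v \sum_p \sum_q
    Q i j * (a G i q * a G u j * a G p v) * expR (theta * (Q i j + Q u v + Q p q)).

Lemma mgf_upper Q theta : (forall i j, 0 <= Q i j) -> 0 <= theta ->
  N * D * (N * D - 3 * D ^+ 2) *
    (\sum_(G in S) arc_sum Q G * expR (theta * arc_sum Q G)) <=
  \sum_(G in S) expR (theta * arc_sum Q G) * switch_mgf theta Q G.
Proof.
move=> Q0 th0.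
have -> : \sum_(G in S) arc_sum Q G * expR (theta * arc_sum Q G) =
    \sum_i \sum_j Q i j * \sum_(G in S) a G i j * expR (theta * arc_sum Q G).
  under [RHS]eq_bigr do under eq_bigr do rewrite mulr_sumr.
  under [RHS]eq_bigr do rewrite exchange_big/=.
  rewrite [RHS]exchange_big/=; apply: eq_bigr => G _.
  rewrite mulr_suml; apply: eq_bigr => i _; rewrite mulr_suml; apply: eq_bigr => j _.
  by rewrite mulrA.
have -> : \sum_(G in S) expR (theta * arc_sum Q G) * switch_mgf theta Q G =
    \sum_i \sum_j Q i j * \sum_u \sum_v \sum_p \sum_q \sum_(G in S)
      expR (theta * arc_sum Q G) * ((a G i q * a G u j * a G p v)
         * expR (theta * (Q i j + Q u v + Q p q))).
  under [RHS]eq_bigr do under eq_bigr do rewrite exchange_big4 mulr_sumr.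
  under [RHS]eq_bigr do rewrite exchange_big/=.
  rewrite [RHS]exchange_big/=; apply: eq_bigr => G _.
  rewrite mulr_sumr; apply: eq_bigr => i _; rewrite mulr_sumr; apply: eq_bigr => j _.
  rewrite !mulr_sumr; apply: eq_bigr => u _; rewrite !mulr_sumr; apply: eq_bigr => v _.
  rewrite !mulr_sumr; apply: eq_bigr => p _; rewrite !mulr_sumr; apply: eq_bigr => q _.
  ring.
rewrite mulr_sumr; apply: ler_sum => i _; rewrite mulr_sumr; apply: ler_sum => j _.
rewrite mulrCA; apply: ler_wpM2l => //.
apply: (@le_trans _ _ (\sum_(G in S) a G i j * expR (theta * arc_sum Q G) *
  (\sum_u \sum_v \sum_p \sum_q
     a G u v * a G p q * ((1 - a G i q) * (1 - a G u j) * (1 - a G p v))))).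
  rewrite mulr_sumr; apply: ler_sum => G GS; rewrite mulrC.
  apply: ler_wpM2l; first by rewrite mulr_ge0 ?expR_ge0.
  apply: (switchable_count_ge (regular_row GS) (regular_col GS)).
  by move=> *; exact: indicator01.
rewrite sum_switchable.
apply: ler_sum => u _; apply: ler_sum => v _; apply: ler_sum => p _.
apply: ler_sum => q _.
rewrite big_mkcondr/=; apply: ler_sum => G GS.
case: ifPn => [uG|_]; last by rewrite !mulr_ge0 ?expR_ge0.
have := arc_sum_switch Q0 uG.
move: uG => /and5P[_ _ _ -> /andP[-> ->]] le.
by rewrite !mul1r -expRD -mulrDr ler_expR ler_wpM2l.
Qed.

(** Here inverse switchings are bounded from below, so absence conditions have a price: those on
    [(u, v)] and [(p, q)] give [2 * D ^+ 4], that on [(i, j)] gives the term in [arc_sum Q G], and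
    [exp(- y) >= 1 - y] gives the quadratic sum. *)
Lemma mgf_lower Q theta : (forall i j, 0 <= Q i j) -> 0 <= theta ->
  \sum_(G in S) expR (- (theta * arc_sum Q G)) *
    ((N * D ^+ 3 - 2 * D ^+ 4) * (\sum_i \sum_j Q i j) - N * D ^+ 3 * arc_sum Q G
      - 3 * theta * (N * D ^+ 3 * \sum_i \sum_j Q i j ^+ 2)) <=
  (N * D) ^+ 2 *
    (\sum_(G in S) arc_sum Q G * expR (- (theta * arc_sum Q G))).
Proof.
move=> Q0 th0.
have -> : \sum_(G in S) arc_sum Q G * expR (- (theta * arc_sum Q G)) =
    \sum_i \sum_j Q i j * \sum_(G in S) a G i j * expR (- (theta * arc_sum Q G)).
  under [RHS]eq_bigr do under eq_bigr do rewrite mulr_sumr.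
  under [RHS]eq_bigr do rewrite exchange_big/=.
  rewrite [RHS]exchange_big/=; apply: eq_bigr => G _.
  rewrite mulr_suml; apply: eq_bigr => i _; rewrite mulr_suml; apply: eq_bigr => j _.
  by rewrite mulrA.
pose U G i j u v p q := (1 - a G i j) * (1 - a G u v) * (1 - a G p q)
  * (a G i q * a G u j * a G p v).
have U0 G i j u v p q : 0 <= U G i j u v p q.
  by rewrite !mulr_ge0// subr_ge0 (andP (indicator01 _)).2.
have U1 G i j u v p q : U G i j u v p q <= a G i q * a G u j * a G p v.
  rewrite /U ler_piMl ?mulr_ge0//.
  by rewrite !mulr_ile1 ?mulr_ge0// ?subr_ge0 ?gerBl// (andP (indicator01 _)).2.
apply: (@le_trans _ _ (\sum_i \sum_j Q i j * \sum_u \sum_v \sum_p \sum_q \sum_(G in S)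
      expR (- (theta * arc_sum Q G)) *
      (U G i j u v p q * (1 - theta * (Q i j + Q u v + Q p q))))); last first.
  rewrite mulr_sumr; apply: ler_sum => i _; rewrite mulr_sumr; apply: ler_sum => j _.
  rewrite [leRHS]mulrCA; apply: ler_wpM2l => //.
  apply: (@le_trans _ _ (\sum_(G in S) a G i j * expR (- (theta * arc_sum Q G)) *
    (\sum_u \sum_v \sum_p \sum_q
       a G u v * a G p q * ((1 - a G i q) * (1 - a G u j) * (1 - a G p v))))); last first.
    rewrite [leRHS]mulr_sumr; apply: ler_sum => G GS; rewrite [leRHS]mulrC.
    apply: ler_wpM2l; first by rewrite mulr_ge0 ?expR_ge0.
    apply: (switchable_count_le (regular_row GS)).
    by move=> *; exact: indicator01.
  rewrite sum_switchable.
  apply: ler_sum => u _; apply: ler_sum => v _; apply: ler_sum => p _.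
  apply: ler_sum => q _.
  rewrite [leRHS]big_mkcondr/=; apply: ler_sum => G GS.
  case: ifPn => [uG|]; last first.
    rewrite /unswitchable /U.
    case: ((i, j) \in G); first by rewrite subrr !(mul0r, mulr0).
    case: ((u, v) \in G); first by rewrite subrr !(mul0r, mulr0).
    case: ((p, q) \in G); first by rewrite subrr !(mul0r, mulr0).
    case: ((i, q) \in G); last by rewrite !(mul0r, mulr0).
    case: ((u, j) \in G); last by rewrite !(mul0r, mulr0).
    by case: ((p, v) \in G) => // _; rewrite !(mul0r, mulr0).
  have le := arc_sum_switch Q0 uG.
  have -> : U G i j u v p q = 1.
    rewrite /U; move: uG => /and5P[/negPf-> /negPf-> /negPf-> -> /andP[-> ->]].
    by rewrite !subr0 !mulr1.
  rewrite mul1r.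
  apply: (@le_trans _ _ (expR (- (theta * arc_sum Q G)) *
      expR (- (theta * (Q i j + Q u v + Q p q))))).
    apply: ler_wpM2l; first exact: expR_ge0.
    exact: expR_ge1Dx.
  rewrite -expRD ler_expR -opprD lerN2 -mulrDr.
  exact: ler_wpM2l.
have -> : \sum_i \sum_j Q i j * \sum_u \sum_v \sum_p \sum_q \sum_(G in S)
      expR (- (theta * arc_sum Q G)) *
      (U G i j u v p q * (1 - theta * (Q i j + Q u v + Q p q))) =
    \sum_(G in S) expR (- (theta * arc_sum Q G)) * \sum_i \sum_j Q i j *
     \sum_u \sum_v \sum_p \sum_q
      (U G i j u v p q * (1 - theta * (Q i j + Q u v + Q p q))).
  under [LHS]eq_bigr do under eq_bigr do rewrite exchange_big4 mulr_sumr.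
  under [LHS]eq_bigr do rewrite exchange_big/=.
  rewrite [LHS]exchange_big/=; apply: eq_bigr => G _.
  rewrite [RHS]mulr_sumr; apply: eq_bigr => i _.
  rewrite [RHS]mulr_sumr; apply: eq_bigr => j _.
  rewrite !mulr_sumr; apply: eq_bigr => u _; rewrite !mulr_sumr; apply: eq_bigr => v _.
  rewrite !mulr_sumr; apply: eq_bigr => p _; rewrite !mulr_sumr; apply: eq_bigr => q _.
  ring.
apply: ler_sum => G GS; apply: ler_wpM2l; first exact: expR_ge0.
have quad := sum_six_quad (regular_row GS) (regular_col GS)
  (fun i j => (andP (indicator01 ((i, j) \in G))).1) Q0.
(* The exact indicator [U] stays in the main term; in the quadratic error, which is subtracted, it
   may be enlarged to the product of the three arcs. *)
apply: (@le_trans _ _ (\sum_i \sum_j Q i j * (\sum_u \sum_v \sum_p \sum_q U G i j u v p q)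
   - theta * \sum_i \sum_j \sum_u \sum_v \sum_p \sum_q
     Q i j * (Q i j + Q u v + Q p q) * (a G i q * a G u j * a G p v))).
  apply: lerB; last first.
    by rewrite (mulrC 3) -!mulrA; apply: ler_wpM2l => //; rewrite -!mulrA in quad *.
  rewrite mulr_sumr /arc_sum mulr_sumr -sumrB; apply: ler_sum => i _.
  rewrite !mulr_sumr -sumrB; apply: ler_sum => j _.
  have := unswitchable_count_ge (regular_row GS) (regular_col GS)
    (fun i j => indicator01 ((i, j) \in G)) i j.
  move=> /(ler_wpM2l (Q0 i j)); apply: le_trans.
  by rewrite le_eqVlt; apply/orP; left; apply/eqP; ring.
rewrite mulr_sumr -sumrB; apply: ler_sum => i _.
rewrite mulr_sumr -sumrB; apply: ler_sum => j _.
rewrite !mulr_sumr -sumrB; apply: ler_sum => u _.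
rewrite !mulr_sumr -sumrB; apply: ler_sum => v _.
rewrite !mulr_sumr -sumrB; apply: ler_sum => p _.
rewrite !mulr_sumr -sumrB; apply: ler_sum => q _.
have := U1 G i j u v p q.
set A := _ * _ * _ => le.
have c0 : 0 <= theta * (Q i j * (Q i j + Q u v + Q p q)).
  by rewrite !mulr_ge0// !addr_ge0.
have := ler_wpM2l c0 le; nra.
Qed.

End Mgf.

(** * Tail bounds for arc sums *)

Section Concentration.
Variables (R : realType) (n d : nat).
Implicit Types (G : digraph n) (Q : 'I_n -> 'I_n -> R).
Hypotheses (d_gt0 : (0 < d)%N) (n_ge : (6 * d <= n)%N).

Local Notation S := (regular_digraphs n d).
Local Notation N := (n%:R : R).
Local Notation D := (d%:R : R).

Definition arc_mean Q : R := D / N * \sum_i \sum_j Q i j.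

Lemma switch_mgf_bounded Q theta b G : (forall i j, 0 <= Q i j <= b) -> 0 <= theta ->
  G \in S ->
  switch_mgf theta Q G <= expR (3 * (theta * b)) * (N * D ^+ 3 * \sum_i \sum_j Q i j).
Proof.
move=> Q0b th0 GS.
rewrite -(sum_six_ij (regular_row R GS) (regular_col R GS)).
rewrite mulr_sumr; apply: ler_sum => i _; rewrite mulr_sumr; apply: ler_sum => j _.
rewrite mulr_sumr; apply: ler_sum => u _; rewrite mulr_sumr; apply: ler_sum => v _.
rewrite mulr_sumr; apply: ler_sum => p _; rewrite mulr_sumr; apply: ler_sum => q _.
rewrite mulrC; apply: ler_wpM2r.
  by rewrite !mulr_ge0//; case/andP: (Q0b i j).
rewrite ler_expR mulrCA; apply: ler_wpM2l => //.
have /andP[_ ?] := Q0b i j; have /andP[_ ?] := Q0b u v; have /andP[_ ?] := Q0b p q; lra.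
Qed.

Lemma switch_mgf_light Q theta G : (forall i j, 0 <= Q i j) -> 0 <= theta ->
  (forall i j, theta * Q i j <= 1) -> G \in S ->
  switch_mgf theta Q G <= N * D ^+ 3 * (\sum_i \sum_j Q i j) +
    3 * expR 3 * theta * (N * D ^+ 3 * \sum_i \sum_j Q i j ^+ 2).
Proof.
move=> Q0 th0 thQ GS.
have quad := sum_six_quad (regular_row R GS) (regular_col R GS)
  (fun i j => (andP (indicator01 R ((i, j) \in G))).1) Q0.
rewrite -(sum_six_ij (regular_row R GS) (regular_col R GS)).
have c0 : 0 <= expR 3 * theta by rewrite mulr_ge0 ?expR_ge0.
have {}quad := ler_wpM2l c0 quad.
rewrite (_ : 3 * expR 3 * theta * _ = expR 3 * theta *
    (3 * (N * D ^+ 3 * \sum_i \sum_j Q i j ^+ 2))); last by ring.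
apply: (le_trans _ (lerD (lexx _) quad)).
rewrite mulr_sumr -big_split/=; apply: ler_sum => i _.
rewrite mulr_sumr -big_split/=; apply: ler_sum => j _.
rewrite mulr_sumr -big_split/=; apply: ler_sum => u _.
rewrite mulr_sumr -big_split/=; apply: ler_sum => v _.
rewrite mulr_sumr -big_split/=; apply: ler_sum => p _.
rewrite mulr_sumr -big_split/=; apply: ler_sum => q _.
set A := _%:R * _ * _; have A0 : 0 <= A by rewrite !mulr_ge0.
set y := Q i j + Q u v + Q p q.
have y0 : 0 <= y by rewrite !addr_ge0.
(* The exponent is a sum of three terms at most 1. Then [exp y - 1 <= y exp y <= y exp 3], the first
   inequality being [exp(- y) >= 1 - y]. *)
have expy : expR (theta * y) <= 1 + expR 3 * theta * y.
  have y3 : theta * y <= 3.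
    by have := thQ i j; have := thQ u v; have := thQ p q; rewrite /y; lra.
  have e3 : expR (theta * y) <= expR 3 by rewrite ler_expR.
  have := ler_wpM2l (expR_ge0 (theta * y)) (expR_ge1Dx (- (theta * y))).
  rewrite expRxMexpNx_1 -(mulrA _ theta).
  have := ler_wpM2r (mulr_ge0 th0 y0) e3.
  lra.
have := ler_wpM2l (mulr_ge0 (Q0 i j) A0) expy. rewrite -/y; lra.
Qed.

Let N_gt0 : 0 < N. Proof. by rewrite ltr0n; lia. Qed.
Let D_gt0 : 0 < D. Proof. by rewrite ltr0n. Qed.
Let x := D / N.
Let x_ge0 : 0 <= x. Proof. by rewrite divr_ge0. Qed.
Let x_le : x <= 6^-1.
Proof.
rewrite ler_pdivrMr// ler_pdivlMl//.
by rewrite -natrM ler_nat.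
Qed.

(** The factor 2 bounds [1 / (1 - 3 d / n)] when [6 d <= n]. The mean is multiplied by a constant,
    but no upper limit is put on [theta]. *)
Lemma arc_sum_upper_tail Q theta b tau : (forall i j, 0 <= Q i j <= b) -> 0 <= theta ->
  #|[set G in S | tau < arc_sum Q G]|%:R <=
    expR (- (theta * (tau - 2 * expR (3 * (theta * b)) * arc_mean Q))) * #|S|%:R.
Proof.
move=> Qb th0; apply: chernoff => //.
have Q0 i j : 0 <= Q i j by case/andP: (Qb i j).
have := mgf_upper d Q0 th0.
set F := \sum_(G in S) _ * _; set m := \sum_(G in S) expR _ => mgf.
have F0 : 0 <= F.
  apply: sumr_ge0 => G _; rewrite mulr_ge0 ?expR_ge0//.
  by apply: sumr_ge0 => i _; apply: sumr_ge0 => j _; rewrite mulr_ge0.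
have {}mgf : (N * D) ^+ 2 * (1 - 3 * x) * F <=
    (N * D) ^+ 2 * (expR (3 * (theta * b)) * arc_mean Q * m).
  rewrite [leLHS](_ : _ = N * D * (N * D - 3 * D ^+ 2) * F); last first.
    by rewrite /x; field; rewrite gt_eqF.
  apply: (le_trans mgf).
  rewrite [leRHS](_ : _ = \sum_(G in S) expR (theta * arc_sum Q G) *
     (expR (3 * (theta * b)) * (N * D ^+ 3 * \sum_i \sum_j Q i j))); last first.
    by rewrite -mulr_suml -/m /arc_mean; field; rewrite gt_eqF.
  apply: ler_sum => G GS; apply: ler_wpM2l; first exact: expR_ge0.
  exact: switch_mgf_bounded.
rewrite -mulrA ler_pM2l ?exprn_gt0 ?mulr_gt0// in mgf.
have : 2^-1 * F <= (1 - 3 * x) * F by apply: ler_wpM2r => //; have := x_le; lra.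
lra.
Qed.

(** Allowance for the shift of the tilted mean away from [arc_mean Q]: the relative error of the
    switching counts, then the growth of the exponential along one switching. *)
Definition light_loss theta Q : R :=
  6 * x * arc_mean Q + 6 * expR 3 * theta * (x * \sum_i \sum_j Q i j ^+ 2).

Lemma arc_sum_deviation Q theta tau : (forall i j, 0 <= Q i j) -> 0 <= theta ->
  (forall i j, theta * Q i j <= 1) ->
  #|[set G in S | tau < `|arc_sum Q G - arc_mean Q| ]|%:R <=
    2 * expR (- (theta * (tau - light_loss theta Q))) * #|S|%:R.
Proof.
move=> Q0 th0 thQ.
set mu := arc_mean Q; set V := \sum_i \sum_j Q i j ^+ 2.
have V0 : 0 <= x * V.
  by rewrite mulr_ge0//; apply: sumr_ge0 => i _; apply: sumr_ge0 => j _; exact: sqr_ge0.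
have mu0 : 0 <= mu.
  by rewrite mulr_ge0//; apply: sumr_ge0 => i _; apply: sumr_ge0.
have xle := x_le; have x0 := x_ge0.
have ND0 : 0 < (N * D) ^+ 2 by rewrite exprn_gt0 ?mulr_gt0.
have up : #|[set G in S | tau < arc_sum Q G - mu]|%:R <=
    expR (- (theta * (tau - light_loss theta Q))) * #|S|%:R.
  apply: chernoff => //.
  have expE G : expR (theta * (arc_sum Q G - mu)) =
      expR (theta * arc_sum Q G) * expR (- (theta * mu)) by rewrite -expRD mulrBr.
  under eq_bigr do rewrite expE mulrA.
  under [X in _ <= _ * X]eq_bigr do rewrite expE.
  rewrite -!mulr_suml [leRHS]mulrA; apply: ler_wpM2r; first exact: expR_ge0.
  under eq_bigr do rewrite mulrBl.
  rewrite sumrB -mulr_sumr.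
  have := mgf_upper d Q0 th0.
  set F := \sum_(G in S) _ * _; set m := \sum_(G in S) expR _ => mgf.
  have m0 : 0 <= m by apply: sumr_ge0 => G _; exact: expR_ge0.
  have {}mgf : (N * D) ^+ 2 * ((1 - 3 * x) * F) <=
      (N * D) ^+ 2 * ((mu + 3 * expR 3 * theta * (x * V)) * m).
    rewrite [leLHS](_ : _ = N * D * (N * D - 3 * D ^+ 2) * F); last first.
      by rewrite /x; field; rewrite gt_eqF.
    apply: (le_trans mgf).
    rewrite [leRHS](_ : _ = \sum_(G in S) expR (theta * arc_sum Q G) *
       (N * D ^+ 3 * (\sum_i \sum_j Q i j) +
        3 * expR 3 * theta * (N * D ^+ 3 * V))); last first.
      by rewrite -mulr_suml -/m /mu /arc_mean /x; field; rewrite gt_eqF.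
    apply: ler_sum => G GS; apply: ler_wpM2l; first exact: expR_ge0.
    exact: switch_mgf_light.
  rewrite ler_pM2l// in mgf.
  set w := expR 3 * theta * (x * V) in mgf *.
  have w0 : 0 <= w * m.
    by apply: mulr_ge0 => //; apply: mulr_ge0 => //; rewrite mulr_ge0// expR_ge0.
  have mum0 : 0 <= mu * m by rewrite mulr_ge0.
  (* [(1 - 3 x)(1 + 6 x) >= 1] because [6 x <= 1]: the origin of the 6 in [light_loss]. *)
  suff : (1 - 3 * x) * F <= (1 - 3 * x) * (mu * m + (6 * x * mu + 6 * w) * m).
    rewrite ler_pM2l; last lra.
    by rewrite /light_loss -/mu -/V /w; lra.
  apply: (le_trans mgf).
  have x6 : 0 <= 1 - 6 * x by lra.
  have h1 := mulr_ge0 (mulr_ge0 x0 x6) mum0.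
  have h2 := mulr_ge0 x6 w0.
  rewrite (_ : 3 * expR 3 * theta * (x * V) = 3 * w); last by rewrite /w; ring.
  clearbody w; lra.
have lo : #|[set G in S | tau < mu - arc_sum Q G]|%:R <=
    expR (- (theta * (tau - light_loss theta Q))) * #|S|%:R.
  apply: chernoff => //.
  have expE G : expR (theta * (mu - arc_sum Q G)) =
      expR (- (theta * arc_sum Q G)) * expR (theta * mu).
    by rewrite -expRD mulrBr addrC.
  under eq_bigr do rewrite expE mulrA.
  under [X in _ <= _ * X]eq_bigr do rewrite expE.
  rewrite -!mulr_suml [leRHS]mulrA; apply: ler_wpM2r; first exact: expR_ge0.
  under eq_bigr do rewrite mulrBl.
  rewrite sumrB -mulr_sumr.
  have := mgf_lower d Q0 th0.
  set F := \sum_(G in S) arc_sum Q G * _; set m := \sum_(G in S) expR (- _) => mgf.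
  have m0 : 0 <= m by apply: sumr_ge0 => G _; exact: expR_ge0.
  have {}mgf : (N * D) ^+ 2 * (((1 - 2 * x) * mu - 3 * theta * (x * V)) * m - x * F)
      <= (N * D) ^+ 2 * F.
    apply: le_trans mgf.
    rewrite le_eqVlt; apply/orP; left; apply/eqP.
    rewrite /F /m mulr_sumr mulr_sumr -sumrB mulr_sumr; apply: eq_bigr => G _.
    by rewrite /mu /arc_mean /x -/V; field; rewrite gt_eqF.
  rewrite ler_pM2l// in mgf.
  have w0 : 0 <= theta * (x * V) * m.
    by apply: mulr_ge0 => //; exact: mulr_ge0.
  have mum0 : 0 <= mu * m by rewrite mulr_ge0.
  (* The term [x * F] stems from the digraphs that already contain [(i, j)]; moved to the right, it
     gives the factor [1 + x]. *)
  suff : (1 + x) * (mu * m - light_loss theta Q * m) <= (1 + x) * F.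
    by rewrite ler_pM2l; last lra; lra.
  have e3 : 1 <= expR 3 :> R by have := expR_ge1Dx (3 : R); lra.
  have h0 : theta * (x * V) * m <= expR 3 * (theta * (x * V) * m) by rewrite ler_peMl.
  have h1 := mulr_ge0 x0 mum0.
  have h2 := mulr_ge0 x0 h1.
  have h3 := mulr_ge0 x0 (mulr_ge0 (expR_ge0 3) w0).
  rewrite /light_loss -/mu -/V; lra.
apply: (@le_trans _ _ (#|[set G in S | tau < arc_sum Q G - mu]|%:R +
                       #|[set G in S | tau < mu - arc_sum Q G]|%:R)); last lra.
rewrite -natrD ler_nat; apply: leq_trans (leq_card_setU _ _).
apply: subset_leq_card; apply/subsetP => G; rewrite !inE lter_normr opprB.
by move=> /andP[-> /orP[]->]; rewrite ?orbT.
Qed.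

End Concentration.

(** * Arcs between two sets *)

Section Discrepancy.
Variables (R : realType) (n : nat).
Implicit Types (G : digraph n) (A B : {set 'I_n}) (s t : nat).

Local Notation N := (n%:R : R).

(* A linear substitute for |A| log(e n / |A|): it is at least that, with equality when
   |A| = n exp(- 3 s), and for each s the sum of exp(- cost) over all sets is at most 1,
   so that the union bound needs no sorting of sets by size. *)
Definition set_cost s A : R := N * expR (- (3 * s%:R)) + 3 * s%:R * #|A|%:R.

(** The sum over sets is a product over vertices: [(1 + y)^n <= exp(n y)] with [y = exp(- 3 s)]. *)
Lemma sum_set_cost s : \sum_(A : {set 'I_n}) expR (- set_cost s A) <= 1.
Proof.
set y := expR (- (3 * s%:R)) : R.
have -> : \sum_(A : {set 'I_n}) expR (- set_cost s A) = expR (- (N * y)) * (1 + y) ^+ n.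
  rewrite -[X in _ ^+ X]card_ord -prodr_const addrC bigA_distr mulr_sumr/=.
  rewrite (eq_bigl predT)//; apply: eq_bigr => A _.
  rewrite /set_cost -/y opprD expRD; congr (_ * _).
  rewrite -big_mkcond/= prodr_const mulrC -mulrN expRM_natl//.
rewrite expRN ler_pdivrMl ?expR_gt0// mulr1 expRM_natl.
by apply: lerXn2r; rewrite ?nnegrE ?addr_ge0 ?expR_ge0// expR_ge1Dx.
Qed.

(** [n exp(- 3 s) = exp(ln n - 3 s) >= 1 + ln n - 3 s]. Costs thus dominate [ln n] and can pay for
    powers of [n]. *)
Lemma set_cost_ge s A : (0 < n)%N -> A != set0 -> 1 + ln N <= set_cost s A.
Proof.
move=> n0 A0.
have N0 : N \is Num.pos by rewrite posrE ltr0n.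
rewrite /set_cost -{2}(lnK N0) -expRD.
have := expR_ge1Dx (ln N + - (3 * s%:R)).
have : 3 * s%:R <= 3 * s%:R * #|A|%:R :> R.
  by rewrite ler_peMr ?mulr_ge0// ler1n card_gt0.
lra.
Qed.

Definition rectangle A B (i j : 'I_n) : R := ((i \in A) && (j \in B))%:R.

Lemma sum_rectangle A B : \sum_i \sum_j rectangle A B i j = #|A|%:R * #|B|%:R.
Proof.
rewrite -[#|A|%:R]sumr_const -[#|B|%:R]sumr_const mulr_suml [RHS]big_mkcond/=.
apply: eq_bigr => i _; rewrite /rectangle; case: (i \in A) => /=; last by rewrite big1.
by rewrite mul1r [RHS]big_mkcond/=; apply: eq_bigr => j _; case: (j \in B).
Qed.

Lemma expR_half_le : expR (2^-1) <= 2 :> R.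
Proof.
have := expR_ge1Dx (- 2^-1 : R); rewrite expRN => le.
by rewrite -[2]invrK -lef_pV2 ?posrE ?invr_gt0 ?expR_gt0// ?invrK; lra.
Qed.

Variables (d h : nat) (K : R).
Hypotheses (d_gt0 : (0 < d)%N) (n_ge : (6 * d <= n)%N) (K0 : 0 < K).
Local Notation D := (d%:R : R).
Local Notation S := (regular_digraphs n d).

(* Truncated subtraction: only used when h < s + t + 2. *)
Definition level_gap s t := (s + t + 2 - h)%N.

(** The threshold given by [arc_sum_upper_tail] at [theta = k / 6], [k] being the gap, where
    [exp(3 theta) <= 2^k]. In [2 + K / 2], one unit pays for the choice of the two sets; the other
    [1 + K / 2], applied to costs that exceed [2 ln n], pay for [n^(-(2 + K))]. *)
Definition rectangle_bound s t A B : R :=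
  2 * 2 ^+ level_gap s t * (D / N * (#|A|%:R * #|B|%:R)) +
  6 * (2 + K / 2) * (set_cost s A + set_cost t B) / (level_gap s t)%:R.

(** Levels range over ['I_n]; the resulting [n^2] couples are absorbed by the 2 in [n^(-(2 + K))].
    Sets are nonempty so that [set_cost_ge] applies. *)
Definition discrepancy G :=
  [forall x : {set 'I_n} * {set 'I_n} * ('I_n * 'I_n),
    [&& x.1.1 != set0, x.1.2 != set0 & (h < x.2.1 + x.2.2 + 2)%N] ==>
    (arc_sum (rectangle x.1.1 x.1.2) G <= rectangle_bound x.2.1 x.2.2 x.1.1 x.1.2)].

Lemma rectangle_tail s t A B : A != set0 -> B != set0 -> (h < s + t + 2)%N ->
  #|[set G in S | rectangle_bound s t A B < arc_sum (rectangle A B) G]|%:R <=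
  N `^ (- (2 + K)) * (expR (- set_cost s A) * expR (- set_cost t B)) * #|S|%:R.
Proof.
move=> A0 B0 hst.
have n0 : (0 < n)%N by lia.
set k := level_gap s t.
have k0 : 0 < k%:R :> R by rewrite ltr0n /k /level_gap subn_gt0.
have Q01 i j : 0 <= rectangle A B i j <= 1 by exact: indicator01.
have th0 : 0 <= k%:R / 6 :> R by rewrite divr_ge0.
apply: (le_trans (arc_sum_upper_tail d_gt0 n_ge _ Q01 th0)).
apply: ler_wpM2r => //.
rewrite -!expRD /powR gt_eqF ?ltr0n// -expRD ler_expR.
have cA := set_cost_ge s n0 A0; have cB := set_cost_ge t n0 B0.
rewrite /arc_mean sum_rectangle /rectangle_bound -/k.
set M := D / N * _.
have M0 : 0 <= M by rewrite !mulr_ge0 ?invr_ge0.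
have e2 : expR (3 * (k%:R / 6 * 1)) <= 2 ^+ k :> R.
  rewrite (_ : 3 * _ = k%:R * 2^-1); last by field.
  rewrite expRM_natl; apply: lerXn2r; rewrite ?nnegrE ?expR_ge0//.
  exact: expR_half_le.
have := ler_wpM2l th0 (ler_wpM2r M0 e2).
set E := expR _; set P := 2 ^+ k; set W := _ + set_cost t B => eM.
rewrite (_ : k%:R / 6 * _ = k%:R / 6 * (2 * P * M - 2 * E * M) + (2 + K / 2) * W); last first.
  by field; rewrite gt_eqF.
have W2 : 0 <= W - 2 * ln N by rewrite /W; lra.
have K2 : 0 <= 1 + K / 2 by rewrite addr_ge0 ?divr_ge0 ?(ltW K0).
have := mulr_ge0 K2 W2; rewrite /W; lra.
Qed.

Lemma discrepancy_fails :
  #|[set G in S | ~~ discrepancy G]|%:R <= N `^ (- K) * #|S|%:R.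
Proof.
have n0 : (0 < n)%N by lia.
have N0 : 0 < N by rewrite ltr0n.
pose I := ({set 'I_n} * {set 'I_n} * ('I_n * 'I_n))%type.
pose P (x : I) := [&& x.1.1 != set0, x.1.2 != set0 & (h < x.2.1 + x.2.2 + 2)%N].
pose E (x : I) G :=
  rectangle_bound x.2.1 x.2.2 x.1.1 x.1.2 < arc_sum (rectangle x.1.1 x.1.2) G.
apply: (@le_trans _ _ #|[set G in S | [exists x, P x && E x G]]|%:R).
  rewrite ler_nat; apply: subset_leq_card; apply/subsetP => G; rewrite !inE.
  move=> /andP[-> /=]; rewrite negb_forall => /existsP[x]; rewrite negb_imply -ltNge => H.
  by apply/existsP; exists x.
apply: le_trans (card_exists_le _ _ _ _) _.
apply: (@le_trans _ _ (\sum_(x : I) N `^ (- (2 + K)) *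
  (expR (- set_cost x.2.1 x.1.1) * expR (- set_cost x.2.2 x.1.2)) * #|S|%:R)).
  rewrite big_mkcond/=; apply: ler_sum => x _.
  case: ifPn => [/and3P[? ? ?]|_]; first exact: rectangle_tail.
  by rewrite !mulr_ge0 ?expR_ge0 ?powR_ge0.
rewrite -mulr_suml; apply: ler_wpM2r => //.
rewrite -mulr_sumr opprD powRD; last by apply/implyP => _; rewrite gt_eqF.
rewrite mulrAC; apply: ler_piMl; first exact: powR_ge0.
rewrite -(pair_bigA _ (fun (ab : {set 'I_n} * {set 'I_n}) (st : 'I_n * 'I_n) =>
  expR (- set_cost st.1 ab.1) * expR (- set_cost st.2 ab.2)))/=.
rewrite exchange_big/=.
apply: (@le_trans _ _ (N `^ (- 2) * \sum_(st : 'I_n * 'I_n) 1)).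
  apply: ler_wpM2l; first exact: powR_ge0.
  apply: ler_sum => -[s t] _ /=.
  rewrite -(pair_bigA _ (fun a b => expR (- set_cost s a) * expR (- set_cost t b)))/=.
  under eq_bigr do rewrite -mulr_sumr.
  rewrite -mulr_suml mulr_ile1 ?sum_set_cost//.
    by apply: sumr_ge0 => *; exact: expR_ge0.
  by apply: sumr_ge0 => *; exact: expR_ge0.
rewrite sumr_const card_prod card_ord natrM.
by rewrite powRN powR_mulrn// -expr2 mulVf// expf_neq0// gt_eqF.
Qed.

End Discrepancy.

(** * Heavy couples *)

Section LevelSums.
Variable R : realType.

Lemma sum_arith_geom m : \sum_(j < m) (1 + j%:R) / 2 ^+ j <= 4 :> R.
Proof.
suff -> : \sum_(j < m) (1 + j%:R) / 2 ^+ j = 4 - (2 * m%:R + 4) / 2 ^+ m :> R.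
  by rewrite gerBl divr_ge0 ?exprn_ge0// addr_ge0 ?mulr_ge0.
elim: m => [|m IH]; first by rewrite big_ord0 expr0; field.
rewrite big_ord_recr/= IH exprS -natr1; field.
by rewrite expf_neq0// pnatr_eq0.
Qed.

Lemma sum_geom m : \sum_(j < m) (2 ^+ j)^-1 <= 2 :> R.
Proof.
suff -> : \sum_(j < m) (2 ^+ j)^-1 = 2 - 2 / 2 ^+ m :> R.
  by rewrite gerBl divr_ge0 ?exprn_ge0.
elim: m => [|m IH]; first by rewrite big_ord0 expr0; field.
by rewrite big_ord_recr/= IH exprS; field; rewrite expf_neq0// pnatr_eq0.
Qed.

Lemma sum_shifted m M :
  \sum_(t < m | (t <= M)%N) (1 + (M - t)%:R) / 2 ^+ (M - t) <= 4 :> R.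
Proof.
pose g j : R := (1 + j%:R) / 2 ^+ j.
have g0 j : 0 <= g j by rewrite divr_ge0 ?exprn_ge0// addr_ge0.
apply: (le_trans _ (sum_arith_geom M.+1)).
rewrite [leRHS](reindex_inj rev_ord_inj)/=.
under [leRHS]eq_bigr do rewrite subSS.
have [mM|Mm] := leqP m M.+1.
  rewrite (big_ord_widen_cond M.+1 (fun t => (t <= M)%N) (fun t => g (M - t)%N))//.
  rewrite big_mkcond; apply: ler_sum => t _.
  by case: ifP => // _; exact: g0.
rewrite (big_ord_widen m (fun t => g (M - t)%N)) ?(ltnW Mm)//.
Qed.

(** * Sums over couples of levels, one side at a time *)

Section Half.
Variables (n d h : nat) (a : 'I_n -> R).
Hypotheses (d_lt : (d < 4 ^ h.+1)%N) (a_ge0 : forall s, 0 <= a s)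
  (a_sum : \sum_(s < n) 4 ^+ s * a s <= 16 * n%:R).
Local Notation N := (n%:R : R).

Lemma d_div_pow2 : d%:R / 2 ^+ h <= 4 * 2 ^+ h :> R.
Proof.
rewrite ler_pdivrMr ?exprn_gt0// -mulrA -exprMn (_ : 2 * 2 = 4); last by ring.
by rewrite -exprS -natrX ler_nat ltnW.
Qed.

(* For z_i much larger than w_j the trivial bound e(S, T) <= d |S| suffices. *)
Lemma steep_levels :
  \sum_(s < n) \sum_(t < n | (t + h < s)%N) 2 ^+ (s + t) * (d%:R * a s) <= 256 * N * 2 ^+ h.
Proof.
apply: (@le_trans _ _ (\sum_(s < n) 4 ^+ s * a s * (16 * 2 ^+ h))); last first.
  rewrite -mulr_suml; have := ler_wpM2r (exprn_ge0 h (ler0n R 2)) a_sum; lra.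
apply: ler_sum => s _.
apply: (@le_trans _ _ (4 ^+ s * a s * (d%:R / 2 ^+ h) *
  \sum_(t < n | (t <= s - h.+1)%N) (1 + (s - h.+1 - t)%:R) / 2 ^+ (s - h.+1 - t))).
  rewrite mulr_sumr big_mkcond [leRHS]big_mkcond/=; apply: ler_sum => t _.
  case: ifPn => [ts|_]; last first.
    case: ifP => // _.
    by rewrite !mulr_ge0 ?exprn_ge0 ?invr_ge0 ?exprn_ge0// addr_ge0.
  have -> : (t <= s - h.+1)%N by lia.
  set j := (s - h.+1 - t)%N.
  have sE : (s = t + h + j + 1 :> nat)%N by rewrite /j; lia.
  have -> : 2 ^+ (s + t) * (d%:R * a s) = 4 ^+ s * a s * (d%:R / 2 ^+ h) * (2^-1 / 2 ^+ j).
    rewrite (_ : 4 = 2 ^+ 2); last by rewrite expr2; ring.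
    rewrite -exprM (_ : (2 * s = s + t + h + j + 1)%N); last by lia.
    rewrite !(exprD _ (s + t + h + j)) !(exprD _ (s + t + h)) !(exprD _ (s + t)) expr1.
    by field; rewrite !expf_neq0// pnatr_eq0.
  apply: ler_wpM2l; first by rewrite !mulr_ge0 ?exprn_ge0 ?invr_ge0 ?exprn_ge0.
  apply: ler_wpM2r; first by rewrite invr_ge0 exprn_ge0.
  have : 0 <= j%:R :> R by []. lra.
have w0 : 0 <= 4 ^+ s * a s by rewrite mulr_ge0 ?exprn_ge0.
rewrite -!mulrA; apply: ler_wpM2l; first exact: exprn_ge0.
apply: ler_wpM2l => //.
have := sum_shifted n (s - h.+1); set X := \sum_(_ < _ | _) _ => X4.
have X0 : 0 <= X.
  by apply: sumr_ge0 => t _; rewrite divr_ge0 ?exprn_ge0// addr_ge0.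
apply: (@le_trans _ _ (4 * 2 ^+ h * 4)); last by lra.
by rewrite mulrA ler_pM// ?divr_ge0 ?exprn_ge0// d_div_pow2.
Qed.

(** The origin of the 3 in [set_cost]: since [exp 3 >= 8], the constant part of the cost, weighted
    by [4^s], is summable over levels. *)
Lemma expR_tilt s : 4 ^+ s * expR (- (3 * s%:R)) <= (2 ^+ s)^-1 :> R.
Proof.
have e2 : 8 <= expR 3 :> R.
  have e1 : 2 <= expR 1 :> R by have := expR_ge1Dx (1 : R); lra.
  rewrite -[3]mulr1 expRM_natl (_ : 8 = 2 ^+ 3); last by rewrite !exprS expr0; ring.
  by apply: lerXn2r; rewrite ?nnegrE ?expR_ge0.
rewrite expRN (mulrC 3) expRM_natl ler_pdivrMr ?exprn_gt0 ?expR_gt0//.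
rewrite ler_pdivlMl ?exprn_gt0// -exprMn.
by apply: lerXn2r; rewrite ?nnegrE ?expR_ge0 ?mulr_ge0//; lra.
Qed.

Definition level_cost (s : 'I_n) : R := N * expR (- (3 * s%:R)) + 3 * s%:R * a s.

(** With [j = s + h - t], [2^(s + t) = 2^h 4^s / 2^j]: the sum over [t] converges in [j], and
    [4^s a_s] is left for the sum over [s]. *)
Lemma level_cost_le (s t : 'I_n) : (t <= s + h)%N -> (h < s + t + 2)%N ->
  2 ^+ (s + t) * (level_cost s / (level_gap h s t)%:R) <=
  2 ^+ h * (N / 2 ^+ s + 3 * (4 ^+ s * a s)) *
   ((1 + (s + h - t)%:R) / 2 ^+ (s + h - t)).
Proof.
clear d_lt; move=> tsh hst.
(* k + j = 2 s + 2, so that s / k <= 1 + j, which the factor 2 ^- j absorbs. *)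
set j := (s + h - t)%N; set k := level_gap h s t.
have k_ge : (s <= k * (1 + j))%N.
  have : (0 < k)%N by rewrite /k /level_gap; lia.
  have : (k + j = 2 * s + 2)%N by rewrite /k /j /level_gap; lia.
  case: (k) => // k'; nia.
have k0 : 0 < k%:R :> R by rewrite ltr0n /k /level_gap; lia.
have -> : 2 ^+ (s + t) = 2 ^+ h * 4 ^+ s / 2 ^+ j :> R.
  rewrite (_ : 4 = 2 ^+ 2); last by rewrite expr2; ring.
  apply/eqP; rewrite eq_sym -subr_eq0 -exprM -exprD.
  rewrite (_ : h + 2 * s = s + t + j)%N; last by rewrite /j; lia.
  by rewrite (exprD _ (s + t)) mulfK ?subrr// expf_neq0// pnatr_eq0.
rewrite [leRHS](_ : _ = 2 ^+ h * 4 ^+ s / 2 ^+ j *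
   ((N * (2 ^+ s * 4 ^+ s)^-1 + 3 * a s) * (1 + j%:R))); last first.
  by field; rewrite !expf_neq0// pnatr_eq0.
apply: ler_wpM2l; first by rewrite !mulr_ge0 ?invr_ge0 ?exprn_ge0.
rewrite ler_pdivrMr//.
have tilt : expR (- (3 * s%:R)) <= (2 ^+ s * 4 ^+ s)^-1 :> R.
  by rewrite invfM -ler_pdivrMr ?invr_gt0 ?exprn_gt0// invrK mulrC expR_tilt.
have jE : 1 + j%:R = (1 + j)%:R :> R by rewrite natrD.
have kj : 1 <= (1 + j%:R) * k%:R :> R.
  rewrite jE -natrM ler1n muln_gt0/=.
  by rewrite -(ltr0n R).
have skj : s%:R <= (1 + j%:R) * k%:R :> R by rewrite jE -natrM ler_nat mulnC.
have X0 : 0 <= (2 ^+ s * 4 ^+ s)^-1 :> R by rewrite invr_ge0 mulr_ge0 ?exprn_ge0.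
move: tilt X0; set X := (_ * _)^-1 => tilt X0.
rewrite [leRHS](_ : _ = N * (X * ((1 + j%:R) * k%:R)) +
  3 * a s * ((1 + j%:R) * k%:R)); last by ring.
apply: lerD.
  apply: ler_wpM2l => //.
  by apply: (le_trans tilt); rewrite ler_peMr.
have := ler_wpM2l (a_ge0 s) skj; lra.
Qed.

Lemma flat_levels :
  \sum_(s < n) \sum_(t < n | (t <= s + h)%N && (h < s + t + 2)%N)
     2 ^+ (s + t) * (level_cost s / (level_gap h s t)%:R) <= 200 * N * 2 ^+ h.
Proof.
apply: (@le_trans _ _ (\sum_(s < n) 2 ^+ h * (N / 2 ^+ s + 3 * (4 ^+ s * a s)) * 4)).
  apply: ler_sum => s _.
  have w0 : 0 <= 2 ^+ h * (N / 2 ^+ s + 3 * (4 ^+ s * a s)).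
    by rewrite mulr_ge0 ?exprn_ge0// addr_ge0 ?divr_ge0 ?mulr_ge0 ?exprn_ge0.
  apply: (le_trans _ (ler_wpM2l w0 (sum_shifted n (s + h)))).
  rewrite mulr_sumr big_mkcond [leRHS]big_mkcond/=; apply: ler_sum => t _.
  case: ifPn => [/andP[ts hs]|_]; first by rewrite ts level_cost_le.
  case: ifP => // _; rewrite mulr_ge0// divr_ge0 ?exprn_ge0// addr_ge0//.
rewrite -mulr_suml -mulr_sumr big_split/= -!mulr_sumr.
have := sum_geom n; set X := \sum_(_ < _) _ => X2.
have as16 := a_sum.
set Y := \sum_(_ < _) _ in as16 *.
(* [50 = 2 + 3 * 16]; the factor 4 of [sum_shifted] makes it 200. *)
have : N * X + 3 * Y <= 50 * N.
  have := ler_wpM2l (ler0n R n) X2; lra.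
move/(ler_wpM2l (exprn_ge0 h (ler0n R 2))); lra.
Qed.

End Half.
End LevelSums.

Section HeavyCouples.
Variable R : realType.

(** Each couple of levels is charged either to a degree bound ([X1], [X2]) or to the mean ([X3]) and
    the two costs ([X4], [X5]): [8704 = 256 + 256 + 8192] and [400 = 200 + 200]. *)
Lemma level_sum_le (n d h : nat) (a b : 'I_n -> R) (e : 'I_n -> 'I_n -> R) (c : R) :
  (0 < n)%N -> (d < 4 ^ h.+1)%N -> 0 <= c ->
  (forall s, 0 <= a s) -> (forall t, 0 <= b t) ->
  \sum_(s < n) 4 ^+ s * a s <= 16 * n%:R -> \sum_(t < n) 4 ^+ t * b t <= 16 * n%:R ->
  (forall s t, e s t <= d%:R * a s) -> (forall s t, e s t <= d%:R * b t) ->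
  (forall s t : 'I_n, (h < s + t + 2)%N -> e s t <=
     2 * 2 ^+ level_gap h s t * (d%:R / n%:R * (a s * b t)) +
     c * (level_cost a s + level_cost b t) / (level_gap h s t)%:R) ->
  \sum_(s < n) \sum_(t < n | (h < s + t + 2)%N) 2 ^+ (s + t) * e s t <=
    (8704 + 400 * c) * n%:R * 2 ^+ h.
Proof.
move=> n0 dh c0 a0 b0 asum bsum ea eb eab.
have N0 : 0 < n%:R :> R by rewrite ltr0n.
have h0 : 0 <= 2 ^+ h :> R by rewrite exprn_ge0.
pose X1 (s t : 'I_n) : R := if (t + h < s)%N then 2 ^+ (s + t) * (d%:R * a s) else 0.
pose X2 (s t : 'I_n) : R := if (s + h < t)%N then 2 ^+ (t + s) * (d%:R * b t) else 0.
pose X3 (s t : 'I_n) : R :=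
  8 * (d%:R / 2 ^+ h) / n%:R * ((4 ^+ s * a s) * (4 ^+ t * b t)).
pose X4 (s t : 'I_n) : R := if (t <= s + h)%N && (h < s + t + 2)%N then
  2 ^+ (s + t) * (level_cost a s / (level_gap h s t)%:R) else 0.
pose X5 (s t : 'I_n) : R := if (s <= t + h)%N && (h < t + s + 2)%N then
  2 ^+ (t + s) * (level_cost b t / (level_gap h t s)%:R) else 0.
have cost0 (f : 'I_n -> R) s : (forall s, 0 <= f s) -> 0 <= level_cost f s.
  by move=> f0; rewrite addr_ge0 ?mulr_ge0 ?expR_ge0.
have X10 s t : 0 <= X1 s t.
  by rewrite /X1; case: ifP => // _; rewrite !mulr_ge0 ?exprn_ge0.
have X20 s t : 0 <= X2 s t.
  by rewrite /X2; case: ifP => // _; rewrite !mulr_ge0 ?exprn_ge0.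
have X30 s t : 0 <= X3 s t.
  by rewrite /X3 !mulr_ge0 ?invr_ge0 ?exprn_ge0.
have X40 s t : 0 <= X4 s t.
  rewrite /X4; case: ifP => // _.
  by rewrite mulr_ge0 ?exprn_ge0// divr_ge0// cost0.
have X50 s t : 0 <= X5 s t.
  rewrite /X5; case: ifP => // _.
  by rewrite mulr_ge0 ?exprn_ge0// divr_ge0// cost0.
have point (s t : 'I_n) : (h < s + t + 2)%N ->
    2 ^+ (s + t) * e s t <= X1 s t + X2 s t + X3 s t + c * X4 s t + c * X5 s t.
  move=> hst.
  have p0 : 0 <= 2 ^+ (s + t) :> R by rewrite exprn_ge0.
  have := mulr_ge0 c0 (X40 s t); have := mulr_ge0 c0 (X50 s t).
  have [ts|st] := ltnP (t + h) s.
    have -> : X1 s t = 2 ^+ (s + t) * (d%:R * a s) by rewrite /X1 ts.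
    have := ler_wpM2l p0 (ea s t); have := X20 s t; have := X30 s t; lra.
  have [ts'|st'] := ltnP (s + h) t.
    have -> : X2 s t = 2 ^+ (s + t) * (d%:R * b t) by rewrite /X2 ts' addnC.
    have := ler_wpM2l p0 (eb s t); have := X10 s t; have := X30 s t; lra.
  move=> _ _.
  have -> : X4 s t = 2 ^+ (s + t) * (level_cost a s / (level_gap h s t)%:R).
    by rewrite /X4 st' hst.
  have -> : X5 s t = 2 ^+ (s + t) * (level_cost b t / (level_gap h s t)%:R).
    by rewrite /X5 /level_gap (addnC t s) st hst.
  have -> : X3 s t = 2 ^+ (s + t) *
      (2 * 2 ^+ level_gap h s t * (d%:R / n%:R * (a s * b t))).
    (* The factor [2^k] on the mean is exactly what completes [2^(s + t)] to [4^s 4^t], so that the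
       sum factors into the two squared norms. *)
    have gE : 2 ^+ level_gap h s t * 2 ^+ h = 4 * (2 ^+ s * 2 ^+ t) :> R.
      rewrite -!exprD (_ : level_gap h s t + h = s + t + 2)%N ?exprD; first by ring.
      by rewrite /level_gap subnK// ltnW.
    rewrite /X3 (_ : 2 ^+ level_gap h s t = 4 * (2 ^+ s * 2 ^+ t) / 2 ^+ h); last first.
      by rewrite -gE mulfK// expf_neq0// pnatr_eq0.
    rewrite (_ : 4 ^+ s = 2 ^+ s * 2 ^+ s); last first.
      by rewrite -exprMn; congr (_ ^+ _); ring.
    rewrite (_ : 4 ^+ t = 2 ^+ t * 2 ^+ t); last first.
      by rewrite -exprMn; congr (_ ^+ _); ring.
    by rewrite exprD; field; rewrite gt_eqF// expf_neq0// pnatr_eq0.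
  have := ler_wpM2l p0 (eab s t hst); have := X10 s t; have := X20 s t.
  rewrite mulrDr; lra.
apply: (@le_trans _ _ (\sum_(s < n) \sum_(t < n)
   (X1 s t + X2 s t + X3 s t + c * X4 s t + c * X5 s t))).
  apply: ler_sum => s _; rewrite big_mkcond; apply: ler_sum => t _.
  case: ifP => [|_]; first exact: point.
  have c4 := mulr_ge0 c0 (X40 s t); have c5 := mulr_ge0 c0 (X50 s t).
  exact: (addr_ge0 (addr_ge0 (addr_ge0 (addr_ge0 (X10 s t) (X20 s t)) (X30 s t)) c4) c5).
have S1 : \sum_(s < n) \sum_(t < n) X1 s t <= 256 * n%:R * 2 ^+ h.
  apply: le_trans (steep_levels dh a0 asum).
  by apply: ler_sum => s _; rewrite -big_mkcond.
have S2 : \sum_(s < n) \sum_(t < n) X2 s t <= 256 * n%:R * 2 ^+ h.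
  apply: le_trans (steep_levels dh b0 bsum).
  by rewrite exchange_big; apply: ler_sum => s _; rewrite -big_mkcond.
have S4 : \sum_(s < n) \sum_(t < n) X4 s t <= 200 * n%:R * 2 ^+ h.
  apply: le_trans (flat_levels h a0 asum).
  by apply: ler_sum => s _; rewrite -big_mkcond.
have S5 : \sum_(s < n) \sum_(t < n) X5 s t <= 200 * n%:R * 2 ^+ h.
  apply: le_trans (flat_levels h b0 bsum).
  by rewrite exchange_big; apply: ler_sum => s _; rewrite -big_mkcond.
have S3 : \sum_(s < n) \sum_(t < n) X3 s t <= 8192 * n%:R * 2 ^+ h.
  under eq_bigr do rewrite -mulr_sumr -mulr_sumr.
  rewrite -mulr_sumr -mulr_suml.
  have Y16 : (\sum_(s < n) 4 ^+ s * a s) * (\sum_(t < n) 4 ^+ t * b t) <=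
      16 * n%:R * (16 * n%:R).
    by apply: ler_pM => //; apply: sumr_ge0 => i _; rewrite mulr_ge0 ?exprn_ge0.
  have k0 : 0 <= 8 * (d%:R / 2 ^+ h) / n%:R :> R.
    by rewrite !mulr_ge0 ?invr_ge0 ?exprn_ge0.
  apply: (le_trans (ler_wpM2l k0 Y16)).
  rewrite [leLHS](_ : _ = 2048 * n%:R * (d%:R / 2 ^+ h)); last first.
    by field; rewrite expf_neq0 ?pnatr_eq0//= gt_eqF.
  have := ler_wpM2l (ler0n R n) (d_div_pow2 R dh); lra.
clearbody X1 X2 X3 X4 X5.
under eq_bigr do rewrite !big_split/= -!mulr_sumr.
rewrite !big_split/= -!mulr_sumr.
have := ler_wpM2l c0 S4; have := ler_wpM2l c0 S5; lra.
Qed.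

End HeavyCouples.

(** * Dyadic levels of a net vector *)

Section Levels.
Variables (R : realType) (n : nat).
Implicit Types z w : 'I_n -> nat.
Hypothesis n_ge3 : (3 <= n)%N.
Local Notation N := (n%:R : R).

(** Zero entries are excluded explicitly, since [trunc_log 2 0 = 0] would place them at level 0. *)
Definition level (z : 'I_n -> nat) (s : nat) : {set 'I_n} :=
  [set i | (0 < z i)%N && (trunc_log 2 (z i) == s)].

(** Makes all levels of a net vector smaller than [n], hence indexed by ['I_n]; the induction starts
    at [48 < 64]. *)
Lemma expn_gt16 : (16 * n < 4 ^ n)%N.
Proof.
have -> : n = (n - 3 + 3)%N by lia.
elim: (n - 3)%N => // m IH; rewrite addSn expnS; lia.
Qed.

Lemma level_bound z : (\sum_i z i ^ 2 <= 16 * n)%N -> forall i, (trunc_log 2 (z i) < n)%N.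
Proof.
move=> zn i; have [->|zi] := posnP (z i); first by rewrite trunc_log0; lia.
have z2 : (z i ^ 2 <= 16 * n)%N by apply: leq_trans zn; rewrite (bigD1 i)//= leq_addr.
have := trunc_logP (isT : (1 < 2)%N) zi; set s := trunc_log 2 _ => sz.
rewrite -(ltn_exp2l _ _ (isT : (1 < 4)%N)) (leq_ltn_trans _ expn_gt16)//.
by apply: leq_trans z2; rewrite -[4%N]/(2 ^ 2)%N -expnM mulnC expnM leq_exp2r.
Qed.

Lemma sum_levels z : (\sum_i z i ^ 2 <= 16 * n)%N ->
  \sum_(s < n) 4 ^+ s * #|level z s|%:R <= 16 * N.
Proof.
move=> zn.
apply: (@le_trans _ _ (\sum_i z i ^ 2)%N%:R); last by rewrite -natrM ler_nat.
have cardE s : #|level z s|%:R = \sum_i (i \in level z s)%:R :> R.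
  by rewrite -sum1_card natr_sum big_mkcond; apply: eq_bigr => i _; case: (_ \in _).
under [leLHS]eq_bigr do rewrite cardE mulr_sumr.
rewrite exchange_big natr_sum/=; apply: ler_sum => i _.
have [zi|zi] := posnP (z i).
  by rewrite big1// => s _; rewrite inE zi mulr0.
have sn := level_bound zn i.
rewrite (bigD1 (Ordinal sn))//= big1 ?addr0 => [|s /negPf sne]; last first.
  by rewrite inE zi/= eq_sym; move: sne; rewrite -val_eqE/= => ->; rewrite mulr0.
rewrite inE zi eqxx mulr1 -natrX ler_nat.
rewrite -[4%N]/(2 ^ 2)%N -expnM mulnC expnM leq_exp2r//.
exact: trunc_logP.
Qed.

Lemma ltn_mul_expn2 (x y s t : nat) :
  (x < 2 ^ s.+1 -> y < 2 ^ t.+1 -> x * y < 2 ^ (s + t + 2))%N.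
Proof.
move=> xs yt; rewrite (_ : s + t + 2 = s.+1 + t.+1)%N; last by lia.
by rewrite expnD ltn_mul.
Qed.

Variables (d h : nat) (K : R).
Hypotheses (K0 : 0 < K) (d_lt : (d < 4 ^ h.+1)%N).

(** On its couple of levels [z i * w j < 4 * 2^(s + t)], hence the factor 4; a heavy couple
    therefore has [h < s + t + 2], that is, a positive gap. *)
Lemma heavy_couples (G : digraph n) z w :
  G \in regular_digraphs n d -> discrepancy d h K G ->
  (\sum_i z i ^ 2 <= 16 * n)%N -> (\sum_i w i ^ 2 <= 16 * n)%N ->
  \sum_i \sum_j (if (2 ^ h < z i * w j)%N then (z i * w j)%:R * ((i, j) \in G)%:R else 0)
   <= 4 * (8704 + 400 * (6 * (2 + K / 2))) * N * 2 ^+ h :> R.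
Proof.
move=> GS disc zn wn.
pose a s : R := #|level z s|%:R; pose b t : R := #|level w t|%:R.
pose e (s t : nat) : R := arc_sum (rectangle R (level z s) (level w t)) G.
have c0 : 0 <= 6 * (2 + K / 2) by rewrite mulr_ge0// addr_ge0// divr_ge0// ltW.
have ea (s t : 'I_n) : e s t <= d%:R * a s.
  rewrite /e /arc_sum /a -sum1_card natr_sum mulr_sumr [leRHS]big_mkcond/=.
  apply: ler_sum => i _; rewrite /rectangle; case: (i \in _); last first.
    by rewrite big1// => j _; rewrite mul0r.
  rewrite mulr1 -(regular_row R GS i); apply: ler_sum => j _.
  by rewrite /=; case: (j \in _); rewrite ?mul1r ?mul0r.
have eb (s t : 'I_n) : e s t <= d%:R * b t.
  rewrite /e /arc_sum /b -sum1_card natr_sum mulr_sumr [leRHS]big_mkcond/= exchange_big/=.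
  apply: ler_sum => j _; rewrite /rectangle; case: (j \in _); last first.
    by rewrite big1// => i _; rewrite andbF mul0r.
  rewrite mulr1 -(regular_col R GS j); apply: ler_sum => i _.
  by rewrite andbT; case: (i \in _); rewrite ?mul1r ?mul0r.
have eab (s t : 'I_n) : (h < s + t + 2)%N -> e s t <=
     2 * 2 ^+ level_gap h s t * (d%:R / N * (a s * b t)) +
     6 * (2 + K / 2) * (level_cost (fun s : 'I_n => a s) s +
       level_cost (fun t : 'I_n => b t) t) / (level_gap h s t)%:R.
  move=> hst.
  have rhs0 : 0 <= 2 * 2 ^+ level_gap h s t * (d%:R / N * (a s * b t)) +
     6 * (2 + K / 2) * (level_cost (fun s : 'I_n => a s) s +
       level_cost (fun t : 'I_n => b t) t) / (level_gap h s t)%:R.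
    apply: addr_ge0; first by rewrite !mulr_ge0 ?exprn_ge0 ?invr_ge0.
    rewrite divr_ge0// mulr_ge0// addr_ge0//.
      by rewrite addr_ge0 ?mulr_ge0 ?expR_ge0.
    by rewrite addr_ge0 ?mulr_ge0 ?expR_ge0.
  (* [discrepancy] concerns nonempty sets; an empty level is settled by the degree bound. *)
  have [A0|A0] := eqVneq (level z s) set0.
    by apply: le_trans rhs0; apply: (le_trans (ea s t)); rewrite /a A0 cards0 mulr0.
  have [B0|B0] := eqVneq (level w t) set0.
    by apply: le_trans rhs0; apply: (le_trans (eb s t)); rewrite /b B0 cards0 mulr0.
  have /forallP/(_ ((level z s, level w t), (s, t)))/= := disc.
  by rewrite A0 B0 hst.
have n0 : (0 < n)%N by lia.
have total := level_sum_le n0 d_lt c0 (fun s => ler0n R _) (fun s => ler0n R _)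
  (sum_levels zn) (sum_levels wn) ea eb eab.
rewrite [leRHS](_ : _ = 4 * ((8704 + 400 * (6 * (2 + K / 2))) * N * 2 ^+ h)); last first.
  by rewrite !mulrA.
apply: (le_trans _ (ler_wpM2l (ler0n R 4) total)).
rewrite [X in 4 * X](eq_bigr (fun s : 'I_n => \sum_i \sum_j \sum_(t < n | (h < s + t + 2)%N)
   2 ^+ (s + t) * (rectangle R (level z s) (level w t) i j * ((i, j) \in G)%:R))); last first.
  move=> s _; under [RHS]eq_bigr do rewrite exchange_big/=.
  rewrite [RHS]exchange_big/=; apply: eq_bigr => t _.
  rewrite /e /arc_sum mulr_sumr; apply: eq_bigr => i _.
  by rewrite mulr_sumr; apply: eq_bigr.
rewrite [X in 4 * X]exchange_big/= mulr_sumr; apply: ler_sum => i _.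
rewrite [X in 4 * X]exchange_big/= mulr_sumr; apply: ler_sum => j _.
have term0 (s t : 'I_n) :
    0 <= 2 ^+ (s + t) * (rectangle R (level z s) (level w t) i j * ((i, j) \in G)%:R) :> R.
  by rewrite !mulr_ge0 ?exprn_ge0.
case: ifP => [zw|_]; last first.
  by rewrite mulr_ge0//; apply: sumr_ge0 => s _; apply: sumr_ge0.
have [zi wj] : (0 < z i)%N /\ (0 < w j)%N.
  by apply/andP; rewrite -muln_gt0; apply: leq_ltn_trans zw.
pose s := Ordinal (level_bound zn i); pose t := Ordinal (level_bound wn j).
have zs : (z i < 2 ^ s.+1)%N by apply: trunc_log_ltn.
have wt : (w j < 2 ^ t.+1)%N by apply: trunc_log_ltn.
have zwst := ltn_mul_expn2 zs wt.
have hst : (h < s + t + 2)%N.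
  by rewrite -(ltn_exp2l _ _ (isT : (1 < 2)%N)) (ltn_trans zw).
apply: (@le_trans _ _ (4 * (2 ^+ (s + t) *
    (rectangle R (level z s) (level w t) i j * ((i, j) \in G)%:R)))).
  rewrite /rectangle !inE zi wj !eqxx/= mul1r mulrA; apply: ler_wpM2r => //.
  by rewrite -natrX -natrM ler_nat (leq_trans (ltnW zwst))// expnD mulnC.
apply: ler_wpM2l => //.
rewrite (bigD1 s)//= (bigD1 t)//= -addrA lerDl.
apply: addr_ge0; first by apply: sumr_ge0 => t' _; exact: (term0 s t').
by apply: sumr_ge0 => s' _; apply: sumr_ge0 => t' _; exact: (term0 s' t').
Qed.

End Levels.

(** * Light couples *)

Section LightCouples.
Variables (R : realType) (n d h : nat).
Implicit Types z w : 'I_n -> nat.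
Hypotheses (d_gt0 : (0 < d)%N) (n_ge : (6 * d <= n)%N) (d_lt : (d < 4 ^ h.+1)%N)
  (d2_le : (d ^ 2 <= n * 2 ^ h)%N).
Local Notation N := (n%:R : R).
Local Notation D := (d%:R : R).
Local Notation S := (regular_digraphs n d).

(** [16 n] is [(4 sqrt n)^2], for a grid of mesh [1 / (4 sqrt n)] in the unit ball. As entries are
    integers, the sum of the entries obeys the same bound. *)
Definition in_net z := (\sum_i z i ^ 2 <= 16 * n)%N.

Lemma leq_sqr_self (m : nat) : (m <= m ^ 2)%N.
Proof. by case: m => // m; rewrite expnS expn1 leq_pmulr. Qed.

Lemma sum_net z : in_net z -> \sum_i (z i)%:R <= 16 * N.
Proof.
move=> zn; rewrite -natr_sum -natrM ler_nat; apply: leq_trans zn.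
by apply: leq_sum => i _; exact: leq_sqr_self.
Qed.

Lemma sum_sqr_net z : in_net z -> \sum_i (z i)%:R ^+ 2 <= 16 * N.
Proof.
move=> zn; under eq_bigr do rewrite -natrX.
by rewrite -natr_sum -natrM ler_nat.
Qed.

Definition light_weight z w (i j : 'I_n) : R :=
  if (z i * w j <= 2 ^ h)%N then (z i * w j)%:R else 0.

(** [1572 = 1536 + 36]: the bound on [light_loss], plus [36 n 2^h], which at [theta = 2^(-h)] gives
    [2 exp(- 36 n)] per couple. The union over [2^(34 n)] couples and the factor 2 use up
    [exp(35 n)]. *)
Definition light_radius : R := (1572 + 6144 * expR 3) * N * 2 ^+ h.

Lemma light_weight_ge0 z w i j : 0 <= light_weight z w i j.
Proof. by rewrite /light_weight; case: ifP. Qed.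

Lemma sum_light_weight z w : in_net z -> in_net w ->
  \sum_i \sum_j light_weight z w i j <= 256 * N ^+ 2.
Proof.
move=> zn wn.
apply: (@le_trans _ _ ((\sum_i (z i)%:R) * (\sum_j (w j)%:R))).
  rewrite mulr_suml; apply: ler_sum => i _; rewrite mulr_sumr; apply: ler_sum => j _.
  by rewrite /light_weight -natrM; case: ifP.
rewrite (_ : 256 * _ = 16 * N * (16 * N)); last by ring.
by apply: ler_pM; rewrite ?sum_net//; exact: sumr_ge0.
Qed.

Lemma sum_light_weight2 z w : in_net z -> in_net w ->
  \sum_i \sum_j light_weight z w i j ^+ 2 <= 256 * N ^+ 2.
Proof.
move=> zn wn.
apply: (@le_trans _ _ ((\sum_i (z i)%:R ^+ 2) * (\sum_j (w j)%:R ^+ 2))).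
  rewrite mulr_suml; apply: ler_sum => i _; rewrite mulr_sumr; apply: ler_sum => j _.
  rewrite /light_weight -exprMn -natrM; case: ifP => // _.
  by rewrite expr0n/= sqr_ge0.
rewrite (_ : 256 * _ = 16 * N * (16 * N)); last by ring.
by apply: ler_pM; rewrite ?sum_sqr_net//; apply: sumr_ge0 => *; exact: sqr_ge0.
Qed.

(** [1536 = 6 * 256] comes from [(d / n)^2 * 256 n^2 = 256 d^2], where [d2_le] carries the degree
    condition of the theorem; [6144 = 6 * 1024] comes from [d / 2^h <= 4 * 2^h]. *)
Lemma light_loss_le z w : in_net z -> in_net w ->
  light_loss d ((2 ^+ h)^-1) (light_weight z w) <= (1536 + 6144 * expR 3) * N * 2 ^+ h.
Proof.
move=> zn wn.
have N0 : 0 < N by rewrite ltr0n; lia.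
have p0 : 0 < 2 ^+ h :> R by rewrite exprn_gt0.
have x0 : 0 <= D / N by rewrite divr_ge0.
have := sum_light_weight zn wn; have := sum_light_weight2 zn wn.
rewrite /light_loss /arc_mean.
set V := \sum_i \sum_j _ ^+ 2; set M := \sum_i \sum_j _ => V_le M_le.
have xxM : D / N * (D / N * M) <= 256 * (N * 2 ^+ h).
  apply: (@le_trans _ _ (D / N * (D / N * (256 * N ^+ 2)))).
    by do 2 apply: ler_wpM2l => //.
  rewrite [leLHS](_ : _ = 256 * D ^+ 2); last by field; rewrite gt_eqF.
  by rewrite ler_wpM2l// -!natrX -natrM ler_nat.
have xV : (2 ^+ h)^-1 * (D / N * V) <= 1024 * (N * 2 ^+ h).
  apply: (@le_trans _ _ ((2 ^+ h)^-1 * (D / N * (256 * N ^+ 2)))).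
    by apply: ler_wpM2l; [rewrite invr_ge0 ltW | exact: ler_wpM2l].
  rewrite [leLHS](_ : _ = 256 * N * (D / 2 ^+ h)); last by field; rewrite !gt_eqF.
  have := ler_wpM2l (ler0n R n) (d_div_pow2 R d_lt); lra.
have := ler_wpM2l (expR_ge0 3) xV.
rewrite -!mulrA; lra.
Qed.

(** A net vector has entries summing to at most [16 n], so its weight [2^(16 n) prod 2^(- z_i)] is
    at least 1; the total weight factors over coordinates, each contributing at most 2. *)
Lemma card_net m :
  #|[set z : {ffun 'I_n -> 'I_m} | in_net (fun i => z i)]|%:R <= 2 ^+ (17 * n) :> R.
Proof.
apply: (@le_trans _ _ (\sum_(z : {ffun 'I_n -> 'I_m})
    2 ^+ (16 * n) * \prod_i (2 ^+ z i)^-1)).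
  rewrite -sum1_card natr_sum big_mkcond/=; apply: ler_sum => z _.
  rewrite prodfV prodrXr inE; case: ifPn => [zn|_]; last first.
    by rewrite divr_ge0 ?exprn_ge0.
  rewrite ler_pdivlMr ?exprn_gt0// mul1r ler_weXn2l ?ler1n//.
  apply: leq_trans zn; apply: leq_sum => i _.
  exact: leq_sqr_self.
rewrite -mulr_sumr -(bigA_distr_bigA (fun _ k => (2 ^+ nat_of_ord k)^-1)) prodr_const card_ord.
rewrite (_ : 17 * n = 16 * n + n)%N; last by lia.
rewrite exprD; apply: ler_wpM2l; first by rewrite exprn_ge0.
apply: lerXn2r; rewrite ?nnegrE ?sum_geom//.
by apply: sumr_ge0 => k _; rewrite invr_ge0 exprn_ge0.
Qed.

(** Entries of net vectors are at most [16 n], so the net embeds in a finite type, over which the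
    union bound is taken. *)
Definition light_controlled (G : digraph n) :=
  [forall zw : {ffun 'I_n -> 'I_(16 * n).+1} * {ffun 'I_n -> 'I_(16 * n).+1},
    in_net (fun i => zw.1 i) && in_net (fun i => zw.2 i) ==>
    (`|arc_sum (light_weight (fun i => zw.1 i) (fun i => zw.2 i)) G
       - arc_mean d (light_weight (fun i => zw.1 i) (fun i => zw.2 i))| <= light_radius)].

Lemma light_controlledP G z w : light_controlled G -> in_net z -> in_net w ->
  `|arc_sum (light_weight z w) G - arc_mean d (light_weight z w)| <= light_radius.
Proof.
move=> ctrl zn wn.
have finE (v : 'I_n -> nat) : in_net v ->
    v = (fun i => [ffun i => inord (v i) : 'I_(16 * n).+1] i).
  move=> vn; apply/funext => i; rewrite ffunE inordK// ltnS.
  apply: leq_trans vn; rewrite (bigD1 i)//= (leq_trans _ (leq_addr _ _))//.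
  exact: leq_sqr_self.
have := forallP ctrl ([ffun i => inord (z i)], [ffun i => inord (w i)]).
by rewrite /= -(finE z zn) -(finE w wn) zn wn.
Qed.

Lemma light_fails :
  #|[set G in S | ~~ light_controlled G]|%:R <= expR (- N) * #|S|%:R.
Proof.
pose I := ({ffun 'I_n -> 'I_(16 * n).+1} * {ffun 'I_n -> 'I_(16 * n).+1})%type.
pose P (x : I) := in_net (fun i => x.1 i) && in_net (fun i => x.2 i).
pose E (x : I) G := light_radius <
  `|arc_sum (light_weight (fun i => x.1 i) (fun i => x.2 i)) G
       - arc_mean d (light_weight (fun i => x.1 i) (fun i => x.2 i))|.
apply: (@le_trans _ _ #|[set G in S | [exists x, P x && E x G]]|%:R).
  rewrite ler_nat; apply: subset_leq_card; apply/subsetP => G; rewrite !inE.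
  move=> /andP[-> /=]; rewrite negb_forall => /existsP[x]; rewrite negb_imply -ltNge => H.
  by apply/existsP; exists x.
apply: le_trans (card_exists_le _ _ _ _) _.
have p0 : 0 < 2 ^+ h :> R by rewrite exprn_gt0.
apply: (@le_trans _ _ (\sum_(x : I | P x) 2 * expR (- (36 * N)) * #|S|%:R)).
  apply: ler_sum => x /andP[zn wn].
  have th0 : 0 <= (2 ^+ h)^-1 :> R by rewrite invr_ge0 ltW.
  have thQ i j : (2 ^+ h)^-1 * light_weight (fun i => x.1 i) (fun i => x.2 i) i j <= 1.
    rewrite ler_pdivrMl// mulr1 /light_weight; case: ifP => [le|_]; last exact: ltW.
    by rewrite -natrX ler_nat.
  apply: (le_trans (arc_sum_deviation d_gt0 n_ge _ (light_weight_ge0 _ _) th0 thQ)).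
  apply: ler_wpM2r => //; apply: ler_wpM2l => //.
  rewrite ler_expR lerN2 ler_pdivlMl//.
  have := light_loss_le zn wn; rewrite /light_radius; lra.
rewrite -mulr_suml; apply: ler_wpM2r => //.
rewrite sumr_const -[leLHS]mulr_natr.
have -> : #|[pred x | P x]| =
    (#|[set z : {ffun 'I_n -> 'I_(16 * n).+1} | in_net (fun i => z i)]| ^ 2)%N.
  rewrite -mulnn -cardsX; apply: eq_card => -[z w].
  by rewrite in_setX !inE.
rewrite natrX.
apply: (@le_trans _ _ (2 * expR (- (36 * N)) * (2 ^+ (17 * n)) ^+ 2)).
  apply: ler_wpM2l; first by rewrite mulr_ge0 ?expR_ge0.
  by apply: lerXn2r; rewrite ?nnegrE ?exprn_ge0 ?card_net.
have two_le : 2 <= expR 1 :> R by have := expR_ge1Dx (1 : R); lra.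
rewrite -exprM mulrAC -exprS.
apply: (@le_trans _ _ (expR (35 * N) * expR (- (36 * N)))); last first.
  by rewrite -expRD ler_expR; lra.
apply: ler_wpM2r; first exact: expR_ge0.
apply: (@le_trans _ _ (2 ^+ (35 * n))).
  by rewrite ler_weXn2l ?ler1n//; lia.
rewrite -natrM -[(35 * n)%:R]mulr1 expRM_natl.
by apply: lerXn2r; rewrite ?nnegrE ?expR_ge0.
Qed.

End LightCouples.

(** * From the net to the operator norm *)

Section NetBound.
Variables (R : realType) (n d h : nat) (K : R) (G : digraph n).
Implicit Types z w : 'I_n -> nat.
Hypotheses (d_gt0 : (0 < d)%N) (n_ge : (6 * d <= n)%N) (d_lt : (d < 4 ^ h.+1)%N)
  (K0 : 0 < K) (GS : G \in regular_digraphs n d) (disc : discrepancy d h K G)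
  (light : light_controlled R d h G).
Local Notation N := (n%:R : R).
Local Notation D := (d%:R : R).

Definition net_constant : R :=
  (1572 + 6144 * expR 3) + 4 * (8704 + 400 * (6 * (2 + K / 2))) + 1024.

Lemma net_bound z w : in_net z -> in_net w ->
  `|\sum_i \sum_j (z i)%:R * (w j)%:R * (((i, j) \in G)%:R - D / N)| <=
  net_constant * N * 2 ^+ h.
Proof.
move=> zn wn.
have N0 : 0 < N by rewrite ltr0n; move: d_gt0 n_ge; lia.
have p0 : 0 < 2 ^+ h :> R by rewrite exprn_gt0.
have x0 : 0 <= D / N by rewrite divr_ge0.
pose H i j : R := if (2 ^ h < z i * w j)%N then (z i * w j)%:R else 0.
have H0 i j : 0 <= H i j by rewrite /H; case: ifP.
have n3 : (3 <= n)%N by move: d_gt0 n_ge; lia.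
have heavy := heavy_couples n3 K0 d_lt GS disc zn wn.
have {}heavy : `|\sum_i \sum_j H i j * ((i, j) \in G)%:R| <=
    4 * (8704 + 400 * (6 * (2 + K / 2))) * N * 2 ^+ h.
  rewrite ger0_norm; last by apply: sumr_ge0 => i _; apply: sumr_ge0 => j _; rewrite mulr_ge0.
  apply: le_trans heavy; apply: ler_sum => i _; apply: ler_sum => j _.
  by rewrite /H; case: ifP => // _; rewrite mul0r.
have mean : `|D / N * \sum_i \sum_j H i j| <= 1024 * N * 2 ^+ h.
  rewrite ger0_norm; last first.
    by rewrite mulr_ge0//; apply: sumr_ge0 => i _; apply: sumr_ge0.
  (* A heavy couple satisfies [z_i w_j <= (z_i w_j)^2 / 2^h], and the sum of these squares
     factors. *)
  have H_le : \sum_i \sum_j H i j <= (16 * N) * (16 * N) / 2 ^+ h.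
    apply: (@le_trans _ _ ((\sum_i (z i)%:R ^+ 2) * (\sum_j (w j)%:R ^+ 2) / 2 ^+ h)).
      rewrite mulr_suml mulr_suml; apply: ler_sum => i _.
      rewrite mulr_sumr mulr_suml; apply: ler_sum => j _.
      rewrite -exprMn -natrM ler_pdivlMr// /H; case: ifP => [/ltnW hzw|_].
        by rewrite expr2 ler_wpM2l// -natrX ler_nat.
      by rewrite mul0r sqr_ge0.
    apply: ler_wpM2r; first by rewrite invr_ge0 ltW.
    by apply: ler_pM; rewrite ?sum_sqr_net//; apply: sumr_ge0 => *; exact: sqr_ge0.
  apply: (le_trans (ler_wpM2l x0 H_le)).
  rewrite [leLHS](_ : _ = 256 * N * (D / 2 ^+ h)); last by field; rewrite !gt_eqF.
  have := ler_wpM2l (ler0n R n) (d_div_pow2 R d_lt); lra.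
have lights := light_controlledP light zn wn.
rewrite (_ : \sum_i \sum_j _ =
   (arc_sum (light_weight R h z w) G - arc_mean d (light_weight R h z w)) +
   \sum_i \sum_j H i j * ((i, j) \in G)%:R - D / N * \sum_i \sum_j H i j); last first.
  rewrite /arc_sum /arc_mean !mulr_sumr -sumrB -big_split -sumrB/=.
  apply: eq_bigr => i _; rewrite !mulr_sumr -sumrB -big_split -sumrB/=.
  apply: eq_bigr => j _; rewrite /light_weight /H leqNgt natrM.
  by case: (2 ^ h < z i * w j)%N => /=; ring.
apply: (le_trans (ler_normB _ _)); apply: (le_trans (lerD (ler_normD _ _) (lexx _))).
move: lights heavy mean; rewrite /light_radius /net_constant; lra.
Qed.

End NetBound.

(** * Successive rounding to the net *)

Section Rounding.
Variables (R : realType) (n : nat) (m : 'I_n -> 'I_n -> R) (b : R).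
Implicit Types (x y v : 'I_n -> R).
Hypotheses (n_gt0 : (0 < n)%N) (m_le1 : forall i j, `|m i j| <= 1)
  (net_le : forall z w : 'I_n -> nat, in_net z -> in_net w ->
     `|\sum_i \sum_j (z i)%:R * (w j)%:R * m i j| <= 16 * n%:R * b).
Local Notation N := (n%:R : R).

Definition bilin x y : R := \sum_i \sum_j x i * y j * m i j.

Definition in_ball x := \sum_i x i ^+ 2 <= 1.

Definition nonneg_bound (B : R) := forall x y, (forall i, 0 <= x i) -> (forall i, 0 <= y i) ->
  in_ball x -> in_ball y -> `|bilin x y| <= B.

Lemma nonneg_bound_trivial : nonneg_bound N.
Proof.
move=> x y x0 y0 xb yb.
apply: (@le_trans _ _ (\sum_(i < n) \sum_(j < n) 2^-1 * (x i ^+ 2 + y j ^+ 2))).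
  apply: (le_trans (ler_norm_sum _ _ _)); apply: ler_sum => i _.
  apply: (le_trans (ler_norm_sum _ _ _)); apply: ler_sum => j _.
  rewrite !normrM (ger0_norm (x0 i)) (ger0_norm (y0 j)).
  have := ler_wpM2l (mulr_ge0 (x0 i) (y0 j)) (m_le1 i j).
  have := sqr_ge0 (x i - y j); nra.
under eq_bigr => i _ do
  rewrite -mulr_sumr big_split/= sumr_const card_ord -[x i ^+ 2 *+ n]mulr_natl.
rewrite -mulr_sumr big_split/= -mulr_sumr sumr_const card_ord -[_ *+ n]mulr_natl.
have := ler_wpM2l (ler0n R n) xb; have := ler_wpM2l (ler0n R n) yb; lra.
Qed.

(** Truncation to the mesh [1 / (4 sqrt n)] leaves an error of norm at most [1 / 4]. Rounding
    downwards keeps it nonnegative, so four times the error, [e], is again a nonnegative vector of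
    the unit ball. *)
Lemma round_down x : (forall i, 0 <= x i) -> in_ball x ->
  exists2 z : 'I_n -> nat, in_net z & exists2 e : 'I_n -> R,
   (forall i, x i = (z i)%:R / (4 * Num.sqrt N) + e i / 4) &
   [/\ forall i, 0 <= e i, in_ball e & in_ball (fun i => (z i)%:R / (4 * Num.sqrt N))].
Proof.
move=> x0 xb.
have N0 : 0 < N by rewrite ltr0n.
set r := 4 * Num.sqrt N.
have r0 : 0 < r by rewrite mulr_gt0// sqrtr_gt0.
have r2 : r ^+ 2 = 16 * N by rewrite exprMn sqr_sqrtr//; ring.
pose z i := Num.truncn (r * x i).
have zP i : (z i)%:R <= r * x i < (z i).+1%:R.
  by rewrite /z Num.Theory.truncn_itv// mulr_ge0// ltW.
have zr i : (z i)%:R / r <= x i by rewrite ler_pdivrMr// mulrC; case/andP: (zP i).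
have zb : in_ball (fun i => (z i)%:R / r).
  apply: le_trans xb; apply: ler_sum => i _.
  by apply: lerXn2r; rewrite ?nnegrE ?divr_ge0// ltW.
exists z.
  rewrite /in_net -(ler_nat R) natr_sum natrM -r2.
  have := ler_wpM2l (sqr_ge0 r) zb; rewrite mulr1 mulr_sumr; apply: le_trans.
  apply: ler_sum => i _; rewrite expr_div_n mulrC mulfVK ?natrX//.
  by rewrite expf_neq0// gt_eqF.
exists (fun i => 4 * (x i - (z i)%:R / r)) => [i|]; first by field; rewrite gt_eqF.
have e0 i : 0 <= x i - (z i)%:R / r by rewrite subr_ge0.
split=> // [i|]; first by rewrite mulr_ge0.
rewrite /in_ball.
apply: (@le_trans _ _ (\sum_(i < n) 16 / r ^+ 2)); last first.
  rewrite sumr_const card_ord -mulr_natr r2 le_eqVlt; apply/orP; left; apply/eqP.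
  by field; rewrite gt_eqF.
apply: ler_sum => i _.
rewrite exprMn (_ : 4 ^+ 2 = 16); last by rewrite expr2; ring.
apply: ler_wpM2l => //; rewrite -exprVn.
apply: lerXn2r; rewrite ?nnegrE ?invr_ge0 ?(ltW r0)//.
rewrite lerBlDr -[X in _ <= X + _]div1r -mulrDl ler_pdivlMr// mulrC.
by case/andP: (zP i) => _ /ltW; rewrite -natr1 addrC.
Qed.

(** The form splits into a net term and two error terms, each carrying a factor [1 / 4] and
    otherwise bounded by [B]. *)
Lemma nonneg_bound_step B : nonneg_bound B -> nonneg_bound (b + B / 2).
Proof.
move=> HB x y x0 y0 xb yb.
have N0 : 0 < N by rewrite ltr0n.
have [z zn [e xE [e0 eb zb]]] := round_down x0 xb.
have [w wn [f yE [f0 fb wb]]] := round_down y0 yb.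
set r := 4 * Num.sqrt N in xE yE zb wb.
have r0 : 0 < r by rewrite mulr_gt0// sqrtr_gt0.
have r2 : r ^+ 2 = 16 * N by rewrite exprMn sqr_sqrtr//; ring.
have z0 i : 0 <= (z i)%:R / r by rewrite divr_ge0// ltW.
have -> : bilin x y = (\sum_i \sum_j (z i)%:R * (w j)%:R * m i j) / r ^+ 2 +
    bilin (fun i => (z i)%:R / r) f / 4 + bilin e y / 4.
  rewrite /bilin !mulr_suml -!big_split/=; apply: eq_bigr => i _.
  rewrite !mulr_suml -!big_split/=; apply: eq_bigr => j _.
  by rewrite yE xE; field; rewrite gt_eqF.
have h1 : `|(\sum_i \sum_j (z i)%:R * (w j)%:R * m i j) / r ^+ 2| <= b.
  rewrite normrM [X in _ * X]ger0_norm ?invr_ge0 ?exprn_ge0 ?(ltW r0)//.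
  by rewrite ler_pdivrMr ?exprn_gt0// r2 mulrC net_le.
have h2 : `|bilin (fun i => (z i)%:R / r) f / 4| <= B / 4.
  rewrite normrM (@ger0_norm _ 4^-1) ?invr_ge0//.
  by apply: ler_wpM2r; [rewrite invr_ge0 | exact: HB].
have h3 : `|bilin e y / 4| <= B / 4.
  rewrite normrM (@ger0_norm _ 4^-1) ?invr_ge0//.
  by apply: ler_wpM2r; [rewrite invr_ge0 | exact: HB].
apply: (le_trans (ler_normD _ _)); apply: (le_trans (lerD (ler_normD _ _) (lexx _))).
lra.
Qed.

(** The map [B -> b + B / 2] has fixed point [2 b]; after [n] iterations from the trivial bound [n],
    the excess is at most [n / 2^n <= 1]. *)
Lemma nonneg_bound_net : nonneg_bound (2 * b + 1).
Proof.
have b0 : 0 <= b.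
  have : in_net (fun _ : 'I_n => 0%N) by rewrite /in_net big1.
  move=> /[dup] zn /(net_le zn) /(le_trans (normr_ge0 _)).
  by rewrite pmulr_rge0// mulr_gt0// ltr0n.
have iter k : nonneg_bound (2 * b + N / 2 ^+ k).
  elim: k => [|k IH] x y x0 y0 xb yb.
    rewrite expr0 divr1; have := nonneg_bound_trivial x0 y0 xb yb; lra.
  have := nonneg_bound_step IH x0 y0 xb yb.
  by rewrite exprS invfM; lra.
move=> x y x0 y0 xb yb; apply: (le_trans (iter n x y x0 y0 xb yb)).
rewrite lerD2l ler_pdivrMr ?exprn_gt0// mul1r -natrX ler_nat.
by rewrite ltnW// ltn_expl.
Qed.

(** Splitting both vectors into positive and negative parts costs the factor 4; the norm of [m v] is
    then read off by testing the form against [m v] itself, normalized. *)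
Lemma operator_bound v :
  \sum_i (\sum_j m i j * v j) ^+ 2 <= (4 * (2 * b + 1)) ^+ 2 * \sum_i v i ^+ 2.
Proof.
set L := 2 * b + 1.
have ball x y : in_ball x -> in_ball y -> bilin x y <= 4 * L.
  move=> xb yb.
  pose pos (u : 'I_n -> R) i : R := if 0 <= u i then u i else 0.
  have pos0 u i : 0 <= pos u i by rewrite /pos; case: ifP.
  have posb u : in_ball u -> in_ball (pos u).
    apply: le_trans; apply: ler_sum => i _; rewrite /pos.
    by case: ifP => // _; rewrite expr0n sqr_ge0.
  have negb u : in_ball u -> in_ball (fun i => - u i).
    by move=> ub; rewrite /in_ball; under eq_bigr do rewrite sqrrN.
  have posE u i : u i = pos u i - pos (fun i => - u i) i.
    by rewrite /pos oppr_ge0; case: (leP 0 (u i)) => ?; case: (leP (u i) 0) => ?; lra.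
  have -> : bilin x y = bilin (pos x) (pos y) - bilin (pos x) (pos (fun i => - y i))
     - bilin (pos (fun i => - x i)) (pos y)
     + bilin (pos (fun i => - x i)) (pos (fun i => - y i)).
    rewrite /bilin -sumrB -sumrB -big_split/=; apply: eq_bigr => i _.
    rewrite -sumrB -sumrB -big_split/=; apply: eq_bigr => j _.
    by rewrite {1}(posE x i) {1}(posE y j); ring.
  have bnd u v' : in_ball u -> in_ball v' -> `|bilin (pos u) (pos v')| <= L.
    by move=> ub vb; apply: nonneg_bound_net => //; exact: posb.
  have := bnd _ _ xb yb; have := bnd _ _ xb (negb _ yb).
  have := bnd _ _ (negb _ xb) yb; have := bnd _ _ (negb _ xb) (negb _ yb).
  rewrite !ler_norml; lra.
pose u i := \sum_j m i j * v j.
rewrite -/(u _); set U := \sum_i u i ^+ 2; set V := \sum_i v i ^+ 2.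
have U0 : 0 <= U by apply: sumr_ge0 => i _; exact: sqr_ge0.
have V0 : 0 <= V by apply: sumr_ge0 => i _; exact: sqr_ge0.
have [->|Une] := eqVneq U 0; first by rewrite mulr_ge0// sqr_ge0.
have Upos : 0 < U by rewrite lt_neqAle eq_sym Une.
have Vpos : 0 < V.
  rewrite lt_neqAle V0 andbT eq_sym; apply: contra_neq Une => /eqP.
  rewrite psumr_eq0 => [/allP v0|i _]; last exact: sqr_ge0.
  apply: big1 => i _; rewrite /u big1 ?expr0n// => j _.
  by have := v0 j (mem_index_enum j); rewrite sqrf_eq0 => /eqP ->; rewrite mulr0.
have normalized (f : 'I_n -> R) F : F = \sum_i f i ^+ 2 -> 0 < F ->
    in_ball (fun i => f i / Num.sqrt F).
  move=> FE Fpos; rewrite /in_ball; under eq_bigr do rewrite expr_div_n.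
  by rewrite -mulr_suml -FE sqr_sqrtr ?(ltW Fpos)// divff ?gt_eqF.
have := ball _ _ (normalized u U erefl Upos) (normalized v V erefl Vpos).
have sU : 0 < Num.sqrt U by rewrite sqrtr_gt0.
have sV : 0 < Num.sqrt V by rewrite sqrtr_gt0.
have -> : bilin (fun i => u i / Num.sqrt U) (fun i => v i / Num.sqrt V) =
    Num.sqrt U / Num.sqrt V.
  transitivity (U / (Num.sqrt U * Num.sqrt V)); last first.
    by rewrite -{1}(sqr_sqrtr U0); field; rewrite !gt_eqF.
  rewrite /U mulr_suml /bilin; apply: eq_bigr => i _.
  rewrite expr2 {2}/u mulr_sumr mulr_suml; apply: eq_bigr => j _.
  by field; rewrite !gt_eqF.
rewrite ler_pdivrMr// => UV.
rewrite -(sqr_sqrtr U0) -(sqr_sqrtr V0) -exprMn.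
by apply: lerXn2r => //; rewrite nnegrE ?(ltW sU)// (le_trans (ltW sU) UV).
Qed.

End Rounding.

(** * The second singular value *)

Section SecondSingularValue.
Variables (R : realType) (n : nat) (A : 'M[R]_n) (L : R).
Hypotheses (L_ge0 : 0 <= L) (A_le : forall v : 'I_n -> R, \sum_j v j = 0 ->
  \sum_i (\sum_j A i j * v j) ^+ 2 <= L ^+ 2 * \sum_j v j ^+ 2).

Local Notation C := (complex R).
Local Open Scope sesquilinear_scope.
Local Notation Re := (@complex.Re R).
Local Notation Im := (@complex.Im R).

Lemma Re_mul_conj_mul (z t : C) : Re (z * t * z^*) = (Re z ^+ 2 + Im z ^+ 2) * Re t.
Proof. by case: z t => a b [c e]; rewrite /= ; ring. Qed.

Lemma Re_mul_conj (z : C) : Re (z * z^*) = Re z ^+ 2 + Im z ^+ 2.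
Proof. by rewrite -[X in X * _]mulr1 Re_mul_conj_mul mulr1. Qed.

Lemma Re_sum (I : finType) (F : I -> C) : Re (\sum_i F i) = \sum_i Re (F i).
Proof. by elim/big_rec2: _ => // i x y _ <-; case: y (F i) => ? ? []. Qed.

Lemma Im_sum (I : finType) (F : I -> C) : Im (\sum_i F i) = \sum_i Im (F i).
Proof. by elim/big_rec2: _ => // i x y _ <-; case: y (F i) => ? ? []. Qed.

(** Courant-Fischer: if two singular values exceeded [L], the span of their eigenvectors would
    contain a nonzero [w] of coordinate sum 0 with [|A w| > L |w|]. Eigenvectors are complex here,
    so the hypothesis is applied to the real and imaginary parts of [w]. *)
Lemma sigma2_le : sigma 2 A <= L.
Proof.
rewrite leNgt; apply/negP => sig_gt.
pose H : 'M[C]_n := map_mx (real_complex R) (A^T *m A).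
pose P := spectralmx H; pose D := spectral_diag H.
pose f i := Num.sqrt (Re (D 0 i)).
have [i1 [i2 [_ f1 f2 i12]]] : exists i1 i2, [/\ true, L < f i1, L < f i2 & i1 != i2].
  (* For [n < 2], [sigma 2 A] is the default value 0, which [L_ge0] rules out. *)
  have cnt : (1 < count (fun x => L < x)%R (singular_values A))%N.
    move: sig_gt; rewrite /sigma/=.
    have : sorted >=%R (singular_values A) by apply: sort_sorted; exact: ge_total.
    case: (singular_values A) => [|a [|b s]]/=; try by rewrite ltNge L_ge0.
    by move=> /andP[ba _] Lb; rewrite Lb (lt_le_trans Lb ba).
  move: cnt; rewrite /singular_values count_sort count_map => cnt.
  have : (1 < #|[pred i | (L < f i)%R]|)%N by rewrite cardE /enum_mem size_filter -enumT.
  by move=> /card_gt1P[i1 [i2 [f1 f2 ne]]]; exists i1, i2.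
have big i : L < f i -> L ^+ 2 < Re (D 0 i).
  rewrite /f !ltNge; apply: contra => le.
  by rewrite -[leRHS](ger0_norm L_ge0) -sqrtr_sqr ler_wsqrtr.
pose e k := \sum_j P k j.
(* A nonzero combination of two eigenvectors whose coordinates sum to 0. *)
have [c [c_supp ce c_ne0]] : exists c : 'rV[C]_n,
    [/\ forall k, k != i1 -> k != i2 -> c 0 k = 0, \sum_k c 0 k * e k = 0 & c != 0].
  have pair_sum (x y : C) : \sum_k (x *+ (k == i1) + y *+ (k == i2)) * e k =
      x * e i1 + y * e i2.
    have one (t : C) i : \sum_k t *+ (k == i) * e k = t * e i.
      by rewrite (bigD1 i)//= eqxx big1 ?addr0// => k /negPf ->; rewrite mul0r.
    by under eq_bigr do rewrite mulrDl; rewrite big_split/= !one.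
  have [e1|e1] := eqVneq (e i1) 0.
    exists (\row_k (1 *+ (k == i1) + 0 *+ (k == i2))); split.
    - by move=> k /negPf k1 /negPf k2; rewrite mxE k1 k2 addr0.
    - by under eq_bigr do rewrite mxE; rewrite pair_sum e1 mulr0 mul0r addr0.
    - apply/eqP => /rowP/(_ i1); rewrite !mxE eqxx mul0rn addr0 => /eqP.
      by rewrite oner_eq0.
  exists (\row_k (e i2 *+ (k == i1) + (- e i1) *+ (k == i2))); split.
  - by move=> k /negPf k1 /negPf k2; rewrite mxE k1 k2 addr0.
  - under eq_bigr do rewrite mxE.
    by rewrite pair_sum mulNr mulrC subrr.
  - apply/eqP => /rowP/(_ i2); rewrite !mxE eqxx eq_sym (negPf i12) add0r => /eqP.
    by rewrite oppr_eq0 (negPf e1).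
pose w := c *m P.
have Pu : P *m P ^t* = 1%:M by apply/unitarymxP; exact: spectral_unitarymx.
have HE : H = P ^t* *m diag_mx D *m P.
  rewrite -(invmx_unitary (spectral_unitarymx H)).
  have HH : H ^t* = H.
    apply/matrixP => i j; rewrite !mxE conj_Creal; last by apply/complex_realP; eexists.
    by congr (real_complex R); apply: eq_bigr => k _; rewrite !mxE mulrC.
  by apply/orthomx_spectralP/normalmxP; rewrite HH.
have wtE : w ^t* = P ^t* *m c ^t* by rewrite /w trmx_mul map_mxM.
have PP : P ^t* *m P = 1%:M by exact: mulmx1C.
have wHw : (w *m H *m w ^t*) 0 0 = \sum_k c 0 k * D 0 k * (c 0 k)^*.
  rewrite wtE HE /w !mulmxA -(mulmxA c P) Pu mulmx1.
  rewrite -(mulmxA _ P) Pu mulmx1 mul_mx_diag mxE.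
  by apply: eq_bigr => k _; rewrite !mxE.
have ww : (w *m w ^t*) 0 0 = \sum_k c 0 k * (c 0 k)^*.
  rewrite wtE /w !mulmxA -(mulmxA c P) Pu mulmx1 mxE.
  by apply: eq_bigr => k _; rewrite !mxE.
have w_sum : \sum_j w 0 j = 0.
  rewrite -[RHS]ce; under eq_bigr do rewrite mxE.
  rewrite exchange_big; apply: eq_bigr => k _.
  by rewrite -mulr_sumr.
clearbody w.
have quad_le : Re ((w *m H *m w ^t*) 0 0) <= L ^+ 2 * Re ((w *m w ^t*) 0 0).
  pose x j := Re (w 0 j); pose y j := Im (w 0 j).
  have x_sum : \sum_j x j = 0 by rewrite -Re_sum w_sum.
  have y_sum : \sum_j y j = 0 by rewrite -Im_sum w_sum.
  have -> : Re ((w *m w ^t*) 0 0) = \sum_j x j ^+ 2 + \sum_j y j ^+ 2.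
    rewrite mxE Re_sum -big_split/=; apply: eq_bigr => j _.
    by rewrite !mxE Re_mul_conj.
  (* [u] is [A w] as a row, so the quadratic form is its squared norm. *)
  pose u := w *m map_mx (real_complex R) A^T.
  have uE i : u 0 i = \sum_j w 0 j * (A i j)%:C%C.
    by rewrite mxE; apply: eq_bigr => j _; rewrite !mxE.
  have -> : Re ((w *m H *m w ^t*) 0 0) =
      \sum_i (\sum_j A i j * x j) ^+ 2 + \sum_i (\sum_j A i j * y j) ^+ 2.
    have -> : w *m H *m w ^t* = u *m u ^t*.
      rewrite /u /H map_mxM trmx_mul map_mxM !mulmxA; congr (_ *m _ *m _).
      apply/matrixP => i j; rewrite !mxE/= conj_Creal//.
      by apply/complex_realP; eexists.
    rewrite mxE Re_sum -big_split/=; apply: eq_bigr => i _.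
    rewrite (mxE _ _ i 0) (mxE _ _ i 0) Re_mul_conj uE Re_sum Im_sum.
    by congr (_ ^+ 2 + _ ^+ 2); apply: eq_bigr => j _; rewrite /x /y;
      case: (w 0 j) => a b /=; ring.
  rewrite mulrDr; apply: lerD; exact: A_le.
have [k ck] : exists k, c 0 k != 0.
  apply/existsP; apply: contraNT c_ne0; rewrite negb_exists => /forallP c0.
  by apply/eqP/rowP => k; rewrite mxE; apply/eqP; have := c0 k; rewrite negbK.
(* Both sides become sums over eigenvalues with weights [|c_k|^2], supported where the eigenvalue
   exceeds [L^2]. *)
move: quad_le; rewrite wHw ww !Re_sum mulr_sumr leNgt => /negP; apply.
pose N k := Re (c 0 k) ^+ 2 + Im (c 0 k) ^+ 2.
have termE k' : Re (c 0 k' * D 0 k' * (c 0 k')^*) = N k' * Re (D 0 k').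
  exact: Re_mul_conj_mul.
have N_gt0 k' : c 0 k' != 0 -> 0 < N k'.
  rewrite /N; case: (c 0 k') => a b; rewrite eq_complex/= negb_and => ab0.
  rewrite lt_neqAle eq_sym paddr_eq0 ?sqr_ge0// !sqrf_eq0 negb_and ab0.
  by rewrite addr_ge0 ?sqr_ge0.
have lt_term k' : c 0 k' != 0 ->
    L ^+ 2 * Re (c 0 k' * (c 0 k')^*) < Re (c 0 k' * D 0 k' * (c 0 k')^*).
  move=> ck'; rewrite termE Re_mul_conj mulrC ltr_pM2l ?N_gt0//; apply: big.
  have [->//|k1] := eqVneq k' i1; have [->//|k2] := eqVneq k' i2.
  by rewrite c_supp ?eqxx in ck'.
rewrite (bigD1 k)//= [ltRHS](bigD1 k)//=; apply: ltr_leD; first exact: lt_term.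
apply: ler_sum => k' _; have [->|/lt_term/ltW//] := eqVneq (c 0 k') 0.
by rewrite !mul0r/= mulr0.
Qed.

End SecondSingularValue.

(** * Conclusion *)

(** The witness has the arcs with [i + j < d] modulo [n]. Nonemptiness keeps [uniform_proba] from
    its junk value. *)
Lemma regular_digraphs_neq0 n d : (d <= n)%N -> regular_digraphs n d != set0.
Proof.
case: n => [_|n dn]; first by apply/set0Pn; exists set0; rewrite inE; apply/forallP => -[].
have card_lt : #|[set k : 'I_n.+1 | (k < d)%N]| = d.
  rewrite -sum1_card (eq_bigl (fun k : 'I_n.+1 => (k < d)%N)) => [|k]; last by rewrite inE.
  by rewrite -(big_ord_widen n.+1 (fun=> 1%N) dn) sum1_card card_ord.
apply/set0Pn; exists [set x : 'I_n.+1 * 'I_n.+1 | ((x.1 + x.2)%R < d)%N].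
rewrite inE; apply/forallP => i; apply/andP; split; apply/eqP; rewrite -[RHS]card_lt.
  rewrite -[RHS](card_preimset _ (addIr i)); apply: eq_card => j.
  by rewrite !inE/=.
rewrite -[RHS](card_preimset _ (addrI i)); apply: eq_card => j.
by rewrite !inE/=.
Qed.

Section Deterministic.
Variables (R : realType) (n d : nat) (G : digraph n).
Hypotheses (n_gt0 : (0 < n)%N) (d_le : (d <= n)%N).
Local Notation N := (n%:R : R).
Local Notation D := (d%:R : R).

Definition centered (i j : 'I_n) : R := ((i, j) \in G)%:R - D / N.

Lemma centered_le1 i j : `|centered i j| <= 1.
Proof.
have N0 : 0 < N by rewrite ltr0n.
have x0 : 0 <= D / N by rewrite divr_ge0.
have x1 : D / N <= 1 by rewrite ler_pdivrMr// mul1r ler_nat.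
by rewrite /centered ler_norml; case: ((i, j) \in G) => /=; lra.
Qed.

Lemma sigma2_net (b : R) :
  (forall z w : 'I_n -> nat, in_net z -> in_net w ->
     `|\sum_i \sum_j (z i)%:R * (w j)%:R * centered i j| <= 16 * N * b) ->
  sigma 2 (adjmx R G) <= 4 * (2 * b + 1).
Proof.
move=> net.
have b0 : 0 <= b.
  have : in_net (fun _ : 'I_n => 0%N) by rewrite /in_net big1.
  move=> /[dup] zn /(net _ _ zn) /(le_trans (normr_ge0 _)).
  by rewrite pmulr_rge0// mulr_gt0// ltr0n.
apply: sigma2_le => [|v v0]; first by rewrite mulr_ge0// addr_ge0// mulr_ge0.
apply: le_trans (operator_bound n_gt0 centered_le1 net v).
rewrite le_eqVlt; apply/orP; left; apply/eqP; apply: eq_bigr => i _; congr (_ ^+ 2).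
rewrite /centered; under [RHS]eq_bigr do rewrite mulrBl.
rewrite sumrB -mulr_sumr v0 mulr0 subr0.
by apply: eq_bigr => j _; rewrite mxE.
Qed.

(** Meant for bounded [n]: entries are at most 1 in absolute value and the entries of a net vector
    sum to at most [16 n]. *)
Lemma sigma2_trivial : sigma 2 (adjmx R G) <= 4 * (2 * (16 * N) + 1).
Proof.
apply: sigma2_net => z w zn wn.
apply: (@le_trans _ _ ((\sum_i (z i)%:R) * (\sum_j (w j)%:R))); last first.
  by apply: ler_pM; rewrite ?sum_net//; exact: sumr_ge0.
rewrite mulr_suml; apply: (le_trans (ler_norm_sum _ _ _)); apply: ler_sum => i _.
rewrite mulr_sumr; apply: (le_trans (ler_norm_sum _ _ _)); apply: ler_sum => j _.
by rewrite !normrM !normr_nat ler_piMr ?mulr_ge0// centered_le1.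
Qed.

End Deterministic.

Lemma degree_bounds (R : realType) (n d : nat) :
  (d%:R : R) <= 2^-1 * (n%:R `^ (2 / 3)) -> (8 * d ^ 3 <= n ^ 2)%N.
Proof.
move=> dn; rewrite -(ler_nat R) natrM !natrX.
have -> : n%:R ^+ 2 = (n%:R `^ (2 / 3)) ^+ 3 :> R.
  by rewrite -[RHS]powR_mulrn ?powR_ge0// -powRrM -[LHS]powR_mulrn//; congr (_ `^ _); field.
have -> : 8 * d%:R ^+ 3 = (2 * d%:R) ^+ 3 :> R by ring.
apply: lerXn2r; rewrite ?nnegrE ?mulr_ge0 ?powR_ge0//; lra.
Qed.

Theorem corollary1p2 (R : realType) (K : R) (hK : 0 < K) :
  exists alpha : R, 0 < alpha /\
    forall n d : nat, (0 < n)%N -> (0 < d)%N ->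
      (d%:R : R) <= 2^-1 * (n%:R `^ (2 / 3)) ->
      1 - n%:R `^ (- K) - expR (- n%:R) <=
        uniform_proba R (regular_digraphs n d)
          (fun G => sigma 2 (adjmx R G) <= alpha * Num.sqrt (d%:R)).
Proof.
have C0 : 0 <= net_constant K.
  have := expR_ge0 (3 : R); rewrite /net_constant; lra.
(* [1 / 2 = 4 * 2 / 16] by [sigma2_net]; 3080 covers its additive 4, and also the value 2948 of
   [sigma2_trivial] at [n = 23]. *)
exists (net_constant K / 2 + 3080); split; first lra.
move=> n d n0 d0 /degree_bounds d3.
set E := fun G => _.
set S := regular_digraphs n d.
have dn : (d <= n)%N by nia.
have S0 : 0 < #|S|%:R :> R.
  by rewrite ltr0n card_gt0 regular_digraphs_neq0.
have N_ge0 : 0 <= n%:R `^ (- K) :> R by exact: powR_ge0.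
have e_ge0 : 0 <= expR (- n%:R) :> R by exact: expR_ge0.
have sqrt_ge1 : 1 <= Num.sqrt d%:R :> R by rewrite -[leLHS]sqrtr1 ler_wsqrtr// ler1n.
suff bad : #|[set G in S | ~~ E G]|%:R <= (n%:R `^ (- K) + expR (- n%:R)) * #|S|%:R.
  rewrite /uniform_proba ler_pdivlMr//.
  have : #|S|%:R = #|[set x in S | E x]|%:R + #|[set G in S | ~~ E G]|%:R :> R.
    rewrite -natrD -(cardsID [set G | E G] S); congr ((_ + _)%:R).
      by congr #|pred_of_set _|; apply/setP => G; rewrite !inE.
    by congr #|pred_of_set _|; apply/setP => G; rewrite !inE andbC.
  move=> SE; lra.
(* If [n < 6 d], then [8 d^3 <= n^2 <= 36 d^2] gives [d <= 4] and [n < 24], within reach of the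
   trivial bound. *)
have [n6|n6] := leqP (6 * d) n; last first.
  have n24 : (n < 24)%N.
    have n2 : (n ^ 2 <= (6 * d) ^ 2)%N by rewrite leq_sqr ltnW.
    have d4 : (8 * d <= 36)%N.
      rewrite -(leq_pmul2r (_ : 0 < d ^ 2)%N) ?expn_gt0 ?d0//.
      by move: d3 n2; rewrite !expnS expn0; lia.
    lia.
  rewrite (_ : [set G in S | ~~ E G] = set0) ?cards0 ?mulr_ge0 ?addr_ge0//.
  apply/setP => G; rewrite !inE; apply/negP => /andP[_ /negP]; apply.
  apply: (le_trans (sigma2_trivial R G n0 dn)).
  have n24' : n%:R <= 23 :> R by rewrite ler_nat.
  have : net_constant K / 2 + 3080 <= (net_constant K / 2 + 3080) * Num.sqrt d%:R.
    by rewrite ler_peMr//; lra.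
  lra.
pose h := trunc_log 4 d.
have h_le : (4 ^ h <= d)%N by exact: trunc_logP.
have h_gt : (d < 4 ^ h.+1)%N by exact: trunc_log_ltn.
(* Squared, this reads [d^4 <= n^2 4^h] and follows from [8 d^3 <= n^2] and [d < 4 * 4^h]. *)
have d2 : (d ^ 2 <= n * 2 ^ h)%N.
  have e4 : (4 ^ h = 2 ^ h * 2 ^ h)%N by rewrite -expnMn.
  rewrite -leq_sqr; move: h_gt; rewrite expnS e4; set e := (2 ^ h)%N => lt.
  have h1 : (8 * d ^ 3 * d <= n ^ 2 * d)%N by rewrite leq_mul2r d3 orbT.
  have h2 : (n ^ 2 * d <= n ^ 2 * (4 * (e * e)))%N by rewrite leq_mul2l (ltnW lt) orbT.
  by move: h1 h2; rewrite !expnS !expn0; nia.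
have pow_h : 2 ^+ h <= Num.sqrt d%:R :> R.
  rewrite -[leLHS]ger0_norm ?exprn_ge0// -sqrtr_sqr ler_wsqrtr//.
  by rewrite -exprM mulnC exprM -natrX -natrX ler_nat.
apply: (@le_trans _ _ (#|[set G in S | ~~ discrepancy d h K G]|%:R +
    #|[set G in S | ~~ light_controlled R d h G]|%:R)); last first.
  rewrite mulrDl; apply: lerD; first exact: discrepancy_fails.
  exact: light_fails.
rewrite -natrD ler_nat; apply: leq_trans (leq_card_setU _ _).
apply: subset_leq_card; apply/subsetP => G; rewrite inE => /andP[GS EG].
rewrite in_setU inE [in X in _ || X]inE GS -negb_and/=.
apply: contraNN EG => /andP[disc light].
rewrite /E.
apply: (@le_trans _ _ (4 * (2 * (net_constant K * 2 ^+ h / 16) + 1))).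
  apply: (sigma2_net n0 dn) => z w zn wn.
  apply: (le_trans (net_bound d0 n6 h_gt hK GS disc light zn wn)).
  by rewrite le_eqVlt; apply/orP; left; apply/eqP; field.
have := ler_wpM2l C0 pow_h; lra.
Qed.
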